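(* Consider the policy optimization problem $\max_{\theta\in\mathbb{R}^d}J(\theta)$, $J(\theta)=\mathbb{E}_{\tau\sim p(\cdot|\theta)}[\mathcal{R}(\tau)]$, with trajectory gradient $g(\tau|\theta)$, and suppose the unbiasedness, boundedness and bounded-variance assumptions (A1)–(A3) listed in the context hold. Let $\epsilon>0$ and choose $$\eta=\frac1{2L},\quad m=\frac{L\sigma}{\sqrt{Q\epsilon}},\quad B=\frac{\sigma\sqrt Q}{L\sqrt\epsilon},\quad \alpha=48,\quad\beta=6,$$ with $L$ and $Q$ the constants of the context. Then the output $\theta_\xi$ of AbaSPIDER-PG satisfies $$\mathbb{E}\|\nabla J(\theta_\xi)\|^2\le\frac{40L}{K+1}\big(J(\theta^* )-J(\theta_0)\big)+\frac\epsilon2,$$ where $K$ denotes the total number of iterations and $\theta^*=\arg\max_{\theta\in\mathbb{R}^d}J(\theta)$.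
   Context: Setting. A discounted MDP with state space $\mathcal{S}$, action space $\mathcal{A}$, transition model $\mathcal{P}(s'|s,a)$, reward $\mathcal{R}(s,a)\in[-R,R]$, discount $\gamma\in[0,1)$, initial state distribution $\rho$, finite horizon $H$; policies $\pi_\theta(\cdot|s)$, $\theta\in\mathbb{R}^d$. $p(\cdot|\theta)$ is the distribution of the trajectory $\tau=(s_0,a_0,\dots,s_{H-1},a_{H-1})$ under $\pi_\theta$ with $s_0\sim\rho$; $\mathcal{R}(\tau)=\sum_{t}\gamma^t\mathcal{R}(s_t,a_t)$ (sum over the time steps of the trajectory). $g(\tau|\theta)$ is a trajectory gradient, for instance REINFORCE, $g=\big(\sum_t\gamma^t\mathcal{R}(s_t,a_t)-b(s_t,a_t)\big)\big(\sum_t\nabla\log\pi_\theta(a_t|s_t)\big)$, or G(PO)MDP, $g=\sum_t(\gamma^t\mathcal{R}(s_t,a_t)-b(s_t,a_t))\sum_{i\le t}\nabla\log\pi_\theta(a_i|s_i)$, with $b$ a bias (baseline) function. Assumptions. (A1) $\mathbb{E}_{\tau\sim p(\cdot|\theta)}[g(\tau|\theta)]=\nabla J(\theta)$ for all $\theta$. (A2) There are finite constants $G,C_H,R\ge0$ with $|\nabla_{\theta_i}\log\pi_\theta(a|s)|\le G$, $|\mathcal{R}(s,a)|\le R$, $|\frac{\partial^2}{\partial\theta_i\partial\theta_j}\log\pi_\theta(a|s)|\le C_H$ for all $(s,a)$, $\theta$, $1\le i,j\le d$. (A3) There is $\sigma^2<\infty$ with $\mathbb{E}_{\tau\sim p(\cdot|\theta)}\|g(\tau|\theta)-\nabla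 J(\theta)\|^2\le\sigma^2$ for all $\theta\in\mathbb{R}^d$. Constants. Under (A1)–(A3) it is known from earlier work (Papini et al. 2018; Xu et al. 2019) that there exist constants $L>0$, $L_g$, $\Gamma$, $\alpha_\omega>0$ such that: $\|\nabla J(\theta_1)-\nabla J(\theta_2)\|\le L\|\theta_1-\theta_2\|$; $\|g(\tau|\theta_1)-g(\tau|\theta_2)\|\le L_g\|\theta_1-\theta_2\|$ for all $\tau$; $\|g(\tau|\theta)\|^2\le\Gamma$; and $\mathbb{E}_{\tau\sim p(\cdot|\theta_1)}\big|1-\frac{p(\tau|\theta_2)}{p(\tau|\theta_1)}\big|^2\le\alpha_\omega\|\theta_1-\theta_2\|^2$. Fix such constants and set $Q=2(L_g^2+\Gamma\alpha_\omega)$. Importance weight: $\omega(\tau|\theta_1,\theta_2)=p(\tau|\theta_2)/p(\tau|\theta_1)$. AbaSPIDER-PG. Inputs: $\theta_0\in\mathbb{R}^d$, $\eta,\epsilon,\alpha,\beta>0$, epoch length $m$, mini-batch size $B$. For $k=0,1,\dots,K$, with $n_k=\lfloor k/m\rfloor m$: if $k\equiv0\pmod m$, draw $\tau_1,\dots,\tau_N$ i.i.d. from $p(\cdot|\theta_k)$ with $N=\frac{\alpha\sigma^2}{\frac\beta m\sum_{i=n_k-m}^{n_k-1}\|v_i\|^2+\epsilon}$ (convention $\|v_{-1}\|=\dots=\|v_{-m}\|=0$) and set $v_k=\frac1N\sum_{i=1}^Ng(\tau_i|\theta_k)$; otherwise draw $\tau_1,\dots,\tau_B$ i.i.d. from $p(\cdot|\theta_k)$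 and set $v_k=\frac1B\sum_{i=1}^B\big(g(\tau_i|\theta_k)-\omega(\tau_i|\theta_k,\theta_{k-1})g(\tau_i|\theta_{k-1})\big)+v_{k-1}$. In both cases $\theta_{k+1}=\theta_k+\eta v_k$. Output: $\theta_\xi$ uniformly at random from $\{\theta_0,\dots,\theta_K\}$. Sizes that are not integers are understood to be rounded. *)

(* Defs.v *)
From HB Require Import structures.
From mathcomp Require Import all_boot all_order all_algebra.
From mathcomp Require Import all_classical all_reals all_analysis.

Set Implicit Arguments.
Unset Strict Implicit.
Unset Printing Implicit Defensive.

Import Order.TTheory GRing.Theory Num.Theory.
Import numFieldNormedType.Exports.

Local Open Scope classical_set_scope.
Local Open Scope ring_scope.

(* The library norm on row vectors is the max norm, not the Euclidean one. *)
Definition enorm (R : realType) d (x : 'rV[R]_d) : R :=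
  Num.sqrt (\sum_(i < d) x 0 i ^+ 2).

Definition partial (R : realType) d (i : 'I_d) (f : 'rV[R]_d -> R)
    (x : 'rV[R]_d) : R :=
  'D_(delta_mx 0 i) f x.

Definition grad (R : realType) d (f : 'rV[R]_d -> R) (x : 'rV[R]_d) :
    'rV[R]_d :=
  \row_(i < d) partial i f x.

(* Batch sizes and epoch lengths are positive integers: a real-valued size is
   rounded up, and to 1 when it is 0. *)
Definition roundup (R : realType) (x : R) : nat := maxn 1 `|Num.ceil x|%N.

(* An alias of [m1 \x m2] on which the sigma-finite instance can be inferred:
   on [m1 \x m2] itself it is shadowed by the instance for subprobabilities. *)
Section prodm.
Context d1 d2 (T1 : measurableType d1) (T2 : measurableType d2) (R : realType).
Context (m1 : {sigma_finite_measure set T1 -> \bar R}).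
Context (m2 : {sigma_finite_measure set T2 -> \bar R}).

Definition prodm : set (T1 * T2)%type -> \bar R := (m1 \x m2)%E.

HB.instance Definition _ := Measure.on prodm.

Lemma prodm_sigma_finite : sigma_finite setT prodm.
Proof.
have /sigma_finiteP[F [TF ndF Foo]] := sigma_finiteT m1.
have /sigma_finiteP[G [TG ndG Goo]] := sigma_finiteT m2.
exists (fun n => F n `*` G n).
  rewrite -setXTT TF TG predeqE => -[x y]; split.
    move=> [/= [n _ Fnx] [k _ Gky]]; exists (maxn n k) => //; split.
    - by move: x Fnx; exact/subsetPset/ndF/leq_maxl.
    - by move: y Gky; exact/subsetPset/ndG/leq_maxr.
  by move=> [n _ []/= ? ?]; split; exists n.
move=> k; have [? ?] := Foo k; have [? ?] := Goo k.
split; first exact: measurableX.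
by rewrite /prodm product_measure1E// lte_mul_pinfty// ge0_fin_numE.
Qed.

HB.instance Definition _ := Measure_isSigmaFinite.Build _ _ _ prodm
  prodm_sigma_finite.

End prodm.

Section tuple_measure.
Context d (T : measurableType d) (R : realType).

Definition tcons n (x : (T * n.-tuple T)%type) : n.+1.-tuple T :=
  [tuple of x.1 :: x.2].

Lemma measurable_tcons n : measurable_fun setT (@tcons n).
Proof. exact: measurable_cons. Qed.

Definition pushforward_tcons n (m : set (T * n.-tuple T)%type -> \bar R) :
    set (n.+1.-tuple T) -> \bar R :=
  pushforward m (@tcons n).

Section instances.
Context n (m : {sigma_finite_measure set (T * n.-tuple T)%type -> \bar R}).

HB.instance Definition _ := Measure.copy (pushforward_tcons m)
  (measure_function_pushforward__canonical__measure_function_Measure m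
     (@measurable_tcons n)).

Lemma pushforward_tcons_sigma_finite :
  sigma_finite setT (pushforward_tcons m).
Proof.
have [F UF mF] := sigma_finiteT m.
pose u (t : n.+1.-tuple T) : (T * n.-tuple T)%type := (thead t, [tuple of behead t]).
have mu : measurable_fun setT u.
  by apply/measurable_fun_pairP; split; [exact: measurable_tnth|
    exact: measurable_behead].
have tconsK : cancel (@tcons n) u.
  by move=> [x t]; congr pair; apply/val_inj.
exists (fun k => u @^-1` F k).
  by rewrite -preimage_bigcup -UF preimage_setT.
move=> k; have [mFk Fkoo] := mF k; split.
  by rewrite -[X in measurable X]setTI; exact: mu.
rewrite /pushforward_tcons /pushforward -comp_preimage.
by rewrite (_ : u \o _ = id)//; apply/funext => x; exact: tconsK.
Qed.

HB.instance Definition _ := Measure_isSigmaFinite.Build _ _ _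
  (pushforward_tcons m) pushforward_tcons_sigma_finite.

End instances.

Fixpoint tuple_measure (mu : {sigma_finite_measure set T -> \bar R}) n :
    {sigma_finite_measure set (n.-tuple T) -> \bar R} :=
  match n return {sigma_finite_measure set (n.-tuple T) -> \bar R} with
  | 0 => \d_([tuple] : 0.-tuple T)
  | n'.+1 => pushforward_tcons (prodm mu (tuple_measure mu n'))
  end.

End tuple_measure.

(* The initial distribution and the transition model are densities with respect
   to sigma-finite reference measures on states and actions (e.g., counting or
   Lebesgue measure), and so are the policies below. *)
Record mdp (R : realType) dS dA (S : measurableType dS)
    (A : measurableType dA) := MDP {
  state_measure : {sigma_finite_measure set S -> \bar R} ;
  action_measure : {sigma_finite_measure set A -> \bar R} ;
  init : S -> R ;
  init_ge0 : forall s, 0 <= init s ;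
  measurable_init : measurable_fun setT init ;
  init1 : (\int[state_measure]_s (init s)%:E = 1)%E ;
  trans : S -> A -> S -> R ;
  trans_ge0 : forall s a s', 0 <= trans s a s' ;
  measurable_trans :
    measurable_fun setT (fun x : S * A * S => trans x.1.1 x.1.2 x.2) ;
  trans1 : forall s a, (\int[state_measure]_s' (trans s a s')%:E = 1)%E ;
  reward : S -> A -> R ;
  measurable_reward : measurable_fun setT (fun x : S * A => reward x.1 x.2) ;
  discount : R ;
  discount_ge0 : 0 <= discount ;
  discount_lt1 : discount < 1
}.

Section policy_gradient.
Context (R : realType) (dS dA : measure_display).
Context (S : measurableType dS) (A : measurableType dA).
Context (M : mdp R S A) (H d : nat).

Local Notation params := 'rV[R]_d.
Local Notation traj := (H.-tuple (S * A)%type).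

Record is_policy (pi : params -> S -> A -> R) : Prop := {
  policy_ge0 : forall theta s a, 0 <= pi theta s a ;
  measurable_policy : forall theta,
    measurable_fun setT (fun x : S * A => pi theta x.1 x.2) ;
  policy1 : forall theta s,
    (\int[action_measure M]_a (pi theta s a)%:E = 1)%E
}.

Context (pi : params -> S -> A -> R).

Fixpoint next_pdf (theta : params) (s : S) (a : A) (l : seq (S * A)) : R :=
  if l is (s', a') :: l' then
    trans M s a s' * pi theta s' a' * next_pdf theta s' a' l'
  else 1.

Definition traj_pdf (theta : params) (tau : traj) : R :=
  if tval tau is (s, a) :: l then
    init M s * pi theta s a * next_pdf theta s a l
  else 1.

Definition traj_measure : {sigma_finite_measure set traj -> \bar R} :=
  tuple_measure (prodm (state_measure M) (action_measure M)) H.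

Definition traj_prob (theta : params) (E : set traj) : R :=
  fine (\int[traj_measure]_(tau in E) (traj_pdf theta tau)%:E).

Definition traj_expect (theta : params) (f : traj -> R) : \bar R :=
  (\int[traj_measure]_tau (traj_pdf theta tau * f tau)%:E)%E.

Definition traj_return (tau : traj) : R :=
  \sum_(t < H) discount M ^+ t * reward M (tnth tau t).1 (tnth tau t).2.

Definition perf (theta : params) : R := fine (traj_expect theta traj_return).

Definition weight (tau : traj) (theta1 theta2 : params) : R :=
  traj_pdf theta2 tau / traj_pdf theta1 tau.

Definition unbiased (g : traj -> params -> params) : Prop :=
  forall theta, differentiable perf theta /\
    forall i : 'I_d,
      traj_expect theta (fun tau => g tau theta 0 i) = (grad perf theta 0 i)%:E.

(* The policies have to be positive for [ln (pi theta s a)] to be the logarithm: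
   [ln] is 0 on nonpositive numbers. *)
Definition bounded_scores (G CH Rmax : R) : Prop :=
  [/\ 0 <= G, 0 <= CH, 0 <= Rmax,
    forall s a, `|reward M s a| <= Rmax &
    forall theta s a, 0 < pi theta s a /\
      let logpi x := ln (pi x s a) in
      forall i j : 'I_d,
        [/\ derivable logpi theta (delta_mx 0 i),
            `|partial i logpi theta| <= G,
            derivable (partial j logpi) theta (delta_mx 0 i) &
            `|partial i (partial j logpi) theta| <= CH]].

Definition bounded_variance (g : traj -> params -> params) (sigma : R) : Prop :=
  forall theta,
    (traj_expect theta
       (fun tau => enorm (g tau theta - grad perf theta) ^+ 2)%R
     <= (sigma ^+ 2)%:E)%E.

Definition problem_constants (g : traj -> params -> params)
    (L Lg Gamma alphaw : R) : Prop :=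
  [/\ 0 < L, 0 < alphaw,
    forall theta1 theta2,
      enorm (grad perf theta1 - grad perf theta2)
      <= L * enorm (theta1 - theta2),
    forall tau theta1 theta2,
      enorm (g tau theta1 - g tau theta2) <= Lg * enorm (theta1 - theta2) /\
      enorm (g tau theta1) ^+ 2 <= Gamma &
    forall theta1 theta2,
      (traj_expect theta1 (fun tau => `|1 - weight tau theta1 theta2| ^+ 2)%R
       <= (alphaw * enorm (theta1 - theta2) ^+ 2)%:E)%E].

Context dO (Omega : measurableType dO) (P : probability Omega R).

(* The events determined by the trajectories drawn before iteration [k]; those
   include the events about [theta_0, ..., theta_k] and about the number of
   trajectories drawn at iteration [k]. *)
Definition history (tau : nat -> nat -> Omega -> traj) (k : nat) :
    set (set Omega) :=
  <<s [set F | exists j i E,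
         [/\ (j < k)%N, measurable E & F = tau j i @^-1` E]] >>.

(* Given the past, [tau k 0, tau k 1, ...] are i.i.d. with law
   [p(. | theta k)]; the algorithm only reads as many of them as the size of
   the batch of iteration [k]. *)
Definition iid_draws (tau : nat -> nat -> Omega -> traj)
    (theta : nat -> Omega -> params) (k : nat) : Prop :=
  (forall i, measurable_fun setT (tau k i)) /\
  forall n (E : 'I_n -> set traj) (F : set Omega),
    (forall i, measurable (E i)) -> history tau k F ->
    P (F `&` [set w | forall i : 'I_n, E i (tau k i w)]) =
    (\int[P]_(w in F) (\prod_(i < n) traj_prob (theta k w) (E i))%:E)%E.

(* In the first epoch [nk] is 0 and truncated subtraction makes the sum empty,
   which is the convention that v_{-m}, ..., v_{-1} are zero. *)
Definition big_batch (sigma eps alpha beta : R) (m : nat)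
    (v : nat -> params) (k : nat) : nat :=
  let nk := (k %/ m * m)%N in
  roundup (alpha * sigma ^+ 2 /
    (beta / m%:R * (\sum_(nk - m <= i < nk) enorm (v i) ^+ 2) + eps)).

Record abaspider_pg (g : traj -> params -> params)
    (theta0 : params) (sigma eta eps alpha beta : R) (m B K : nat)
    (tau : nat -> nat -> Omega -> traj) (theta v : nat -> Omega -> params) :
    Prop := {
  abaspider_init : forall w, theta 0 w = theta0 ;
  abaspider_draws : forall k, (k <= K)%N -> iid_draws tau theta k ;
  abaspider_big : forall k w, (k <= K)%N -> (m %| k)%N ->
    let N := big_batch sigma eps alpha beta m (v ^~ w) k in
    v k w = N%:R^-1 *: \sum_(i < N) g (tau k i w) (theta k w) ;
  abaspider_small : forall k w, (k <= K)%N -> ~~ (m %| k)%N ->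
    v k w =
      B%:R^-1 *: (\sum_(i < B)
        (g (tau k i w) (theta k w) -
         weight (tau k i w) (theta k w) (theta k.-1 w) *:
           g (tau k i w) (theta k.-1 w)))
      + v k.-1 w ;
  abaspider_step : forall k w, (k <= K)%N ->
    theta k.+1 w = theta k w + eta *: v k w
}.

(* [xi] is uniform on {0, ..., K} and independent of the run. *)
Definition uniform_output (K : nat) (tau : nat -> nat -> Omega -> traj)
    (xi : Omega -> 'I_K.+1) : Prop :=
  forall j : 'I_K.+1, measurable (xi @^-1` [set j]) /\
    forall F, history tau K.+1 F ->
      P (F `&` xi @^-1` [set j]) = (P F * (K.+1%:R^-1)%:E)%E.

End policy_gradient.

(* Main.v *)
Require Import Defs.
From HB Require Import structures.
From mathcomp Require Import all_boot all_order all_algebra.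
From mathcomp Require Import all_classical all_reals all_analysis.
From mathcomp Require Import measurable_realfun.
From mathcomp Require Import ring lra zify.

Import Order.TTheory GRing.Theory Num.Theory.
Import numFieldNormedType.Exports.

Set Implicit Arguments.
Unset Strict Implicit.
Unset Printing Implicit Defensive.

Local Open Scope classical_set_scope.
Local Open Scope ring_scope.

(** Write e_k = v_k - grad J(theta_k) for the error of the gradient estimate. As
    J is L-smooth and eta = 1 / (2 L), one step satisfies
      |grad J(theta_k)|^2 + |v_k|^2 / 2
        <= 4 L (J(theta_{k+1}) - J(theta_k)) + |e_k|^2
    ([ascent_step]), and the sum over k telescopes. It remains to bound the
    expected squared errors by the expected |v_k|^2, with a total coefficient
    below the 1/2 on the left.

    Given the past, the trajectories of iteration k are i.i.d. with law
    p(. | theta_k). So e_k is an error inherited from the past plus a weighted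
    sum of conditionally independent centered vectors, and squared norms add up
    in expectation ([batch_second_moment]). At the start of an epoch nothing is
    inherited, and the batch size is chosen to make the variance at most
    (beta / m * S + eps) / alpha, where S sums |v_i|^2 over the previous epoch
    ([error_big]). Inside an epoch importance weighting makes the increment
    unbiased, with a variance of at most
    Q |theta_{k+1} - theta_k|^2 = Q eta^2 |v_k|^2 per trajectory ([error_small]).
    In the sum over the run ([epoch_sum]) each |v_i|^2 is charged by at most m
    iterations through the restart of the next epoch and by at most m - 1 later
    iterations of its own epoch. The choice of m and B bounds the second charge
    by 1/4, the first one is 6/48, and 1/4 + 1/8 < 1/2. The eps / alpha of the
    restarts contribute eps / 48 per iteration. Since xi is independent of the
    run, the expectation at theta_xi is the average over the iterations
    ([mean_output]).

    The conditional computation rests on [ge0_integral_freezing]: a function of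
    the past and of the batch may be integrated over the batch first, with the
    past frozen. It asks for joint measurability in the past and the
    trajectories, whereas g, grad J and the trajectory density are measurable in
    the trajectory and continuous in the parameter; [measurable_fun_caratheodory]
    closes that gap. The density is continuous because bounded scores make the
    logarithm of the policy Lipschitz ([continuous_policy]). *)

(** * Measures with a density, and laws determined on a pi-system *)

Section density.
Local Open Scope ereal_scope.
Context d (T : measurableType d) (R : realType).
Context (mu : {measure set T -> \bar R}) (q : T -> R).
Hypotheses (mq : measurable_fun setT q) (q0 : forall x, (0 <= q x)%R).

(** The measure of density q with respect to mu. The two proofs are arguments so
    that the measure instance can be attached to the function. *)
Definition density of measurable_fun setT q & (forall x, (0 <= q x)%R) :
    set T -> \bar R :=
  fun E => \int[mu]_(x in E) (q x)%:E.

Local Notation dens := (density mq q0).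


Let dens0 : dens set0 = 0.
Proof. by rewrite /density integral_set0. Qed.

Let dens_ge0 E : 0 <= dens E.
Proof. by apply: integral_ge0 => x _; rewrite lee_fin. Qed.

Let dens_sigma_additive : semi_sigma_additive dens.
Proof.
move=> F mF tF mUF; rewrite /density ge0_integral_bigcup//.
- by apply: is_cvg_nneseries => n _ _; exact: dens_ge0.
- exact/measurable_EFinP/measurable_funTS.
- by move=> x _; rewrite lee_fin.
Qed.

HB.instance Definition _ :=
  isMeasure.Build _ _ _ dens dens0 dens_ge0 dens_sigma_additive.

Import HBNNSimple.

Lemma ge0_integral_density (f : T -> \bar R) :
  measurable_fun setT f -> (forall x, 0 <= f x) ->
  \int[dens]_x f x = \int[mu]_x ((q x)%:E * f x).
Proof.
move=> mf f0; pose f_ := nnsfun_approx measurableT mf.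
have f_f x : (f_ n x)%:E @[n --> \oo] --> f x by exact: cvg_nnsfun_approx.
transitivity (limn (fun n => \int[dens]_x (f_ n x)%:E)).
  rewrite -monotone_convergence//=; last 3 first.
  - by move=> n; exact/measurable_EFinP.
  - by move=> n x _; rewrite lee_fin; exact: fun_ge0.
  - by move=> x _ a b ab; rewrite lee_fin; exact/lefP/nd_nnsfun_approx.
  by apply: eq_integral => x _; apply/esym/cvg_lim => //; exact: f_f.
transitivity (limn (fun n => \int[mu]_x ((q x)%:E * (f_ n x)%:E))); last first.
  rewrite -monotone_convergence//=; last 3 first.
  - move=> n; apply: emeasurable_funM; exact/measurable_EFinP.
  - by move=> n x _; rewrite mule_ge0// lee_fin// fun_ge0.
  - move=> x _ a b ab; rewrite lee_wpmul2l ?lee_fin//.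
    exact/lefP/nd_nnsfun_approx.
  by apply: eq_integral => x _; apply/cvg_lim => //; apply: cvgeZl => //; exact: f_f.
congr (limn _); apply/funext => n.
under [LHS]eq_integral do rewrite fimfunE -fsumEFin//.
rewrite [LHS]ge0_integral_fsum//; last 2 first.
- by move=> r; exact/measurable_EFinP/measurableT_comp.
- by move=> r x _; rewrite EFinM nnfun_muleindic_ge0.
under [RHS]eq_integral => x _.
  rewrite fimfunE -fsumEFin// ge0_mule_fsumr//; last first.
    by move=> r; rewrite EFinM nnfun_muleindic_ge0.
  over.
rewrite [RHS]ge0_integral_fsum//; last 2 first.
- move=> r; apply: emeasurable_funM; first exact/measurable_EFinP/measurable_funTS.
  exact/measurable_EFinP/measurableT_comp.
- move=> r x _; apply: mule_ge0; first by rewrite lee_fin.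
  by rewrite EFinM nnfun_muleindic_ge0.
apply: eq_fsbigr => r _.
have mA : measurable (f_ n @^-1` [set r]) by [].
have [r0|r0] := leP 0%R r; last first.
  rewrite preimage_nnfun0//.
  rewrite integral0_eq => [|x _]; last by rewrite indic0 mulr0.
  by rewrite integral0_eq => // x _; rewrite indic0 mulr0 mule0.
under [LHS]eq_integral do rewrite EFinM.
rewrite [LHS]ge0_integralZl//; last exact/measurable_EFinP.
rewrite integral_indic// setIT /density.
under [RHS]eq_integral do rewrite EFinM muleCA.
rewrite [RHS]ge0_integralZl//; last 2 first.
- apply: emeasurable_funM; first exact/measurable_EFinP/measurable_funTS.
  exact/measurable_EFinP.
- by move=> x _; rewrite mule_ge0 ?lee_fin.
congr (_ * _); rewrite [LHS]integral_mkcond; apply: eq_integral => x _.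
by rewrite patchE indicE; case: ifP => _; rewrite ?mule1 ?mule0.
Qed.

End density.

(** If the law of f under P and the measure of density q agree on a pi-system
    that generates the sigma-algebra, they are equal, and integrals of functions
    of f can be computed with the density. *)
Lemma ge0_integral_law dX dZ (X : measurableType dX) (Z : measurableType dZ)
    (R : realType) (P : {measure set X -> \bar R})
    (mu : {measure set Z -> \bar R}) (q : Z -> R) (G : set (set Z))
    (f : X -> Z) (h : Z -> \bar R) :
  measurable = <<s G >> -> setI_closed G -> G setT ->
  (P setT < +oo)%E ->
  measurable_fun setT q -> (forall z, 0 <= q z) -> measurable_fun setT f ->
  (forall E, G E -> P (f @^-1` E) = (\int[mu]_(z in E) (q z)%:E)%E) ->
  measurable_fun setT h -> (forall z, (0 <= h z)%E) ->
  (\int[P]_x h (f x) = \int[mu]_z ((q z)%:E * h z))%E.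
Proof.
move=> mG GI GT Pfin mq q0 mf PE mh h0.
rewrite -(ge0_integral_density mu mq q0 mh h0).
have := @ge0_integral_pushforward _ _ _ _ _ _ mf P setT h measurableT mh.
rewrite preimage_setT => <-//.
apply: eq_measure_integral => A mA _.
pose mphi_mixin := isMeasurableFun.Build _ _ _ _ _ mf.
pose F : {mfun X >-> Z} := HB.pack f mphi_mixin.
apply: (measure_unique G (fun=> setT) mG GI _ _ (pushforward P F : {measure set Z ->
    \bar R})) => //.
by rewrite bigcup_const.
Qed.

(** * Integration over tuples *)

Section tuple_measure_theory.
Context d (T : measurableType d) (R : realType).
Context (mu : {sigma_finite_measure set T -> \bar R}).

Lemma ge0_integral_tuple_measureS n (f : n.+1.-tuple T -> \bar R) :
  measurable_fun setT f -> (forall t, (0 <= f t)%E) ->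
  (\int[tuple_measure mu n.+1]_t f t =
   \int[mu]_x \int[tuple_measure mu n]_t f (tcons (x, t)))%E.
Proof.
move=> mf f0.
transitivity (\int[prodm mu (tuple_measure mu n)]_z f (tcons z))%E.
  have := @ge0_integral_pushforward _ _ _ _ _ _ (@measurable_tcons _ T n)
    (prodm mu (tuple_measure mu n)) setT f measurableT mf.
  by rewrite preimage_setT; apply=> y _; exact: f0.
rewrite /prodm (fubini_tonelli1 (fun z => f (tcons z)))//=.
by apply: measurableT_comp => //; exact: measurable_tcons.
Qed.

Lemma integral_tuple_measure0 (f : 0.-tuple T -> \bar R) :
  measurable_fun setT f ->
  (\int[tuple_measure mu 0]_t f t = f [tuple])%E.
Proof. by move=> mf; rewrite /= integral_dirac// diracT mul1e. Qed.

Lemma measurable_fun_prod_tnth n (g : 'I_n -> T -> R) :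
  (forall i, measurable_fun setT (g i)) ->
  measurable_fun setT (fun t : n.-tuple T => \prod_(i < n) g i (tnth t i)).
Proof.
move=> mg; apply: measurable_prod => i _.
by apply: measurableT_comp => //; exact: measurable_tnth.
Qed.

(** Under a product measure, coordinates are independent. *)
Lemma integral_tuple_prod n (f : 'I_n -> T -> R) (c : 'I_n -> R) :
  (forall i, measurable_fun setT (f i)) -> (forall i x, 0 <= f i x) ->
  (forall i, (\int[mu]_x (f i x)%:E = (c i)%:E)%E) ->
  (\int[tuple_measure mu n]_t (\prod_(i < n) f i (tnth t i))%:E =
   (\prod_(i < n) c i)%:E)%E.
Proof.
elim: n f c => [|n IH] f c mf f0 fc.
  rewrite integral_tuple_measure0; first by rewrite !big_ord0.
  by apply/measurable_EFinP; exact: measurable_fun_prod_tnth.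
have fp0 k (h : 'I_k -> 'I_n.+1) (t : k.-tuple T) :
  (0 <= (\prod_(i < k) f (h i) (tnth t i))%:E)%E.
  by rewrite lee_fin prodr_ge0.
rewrite ge0_integral_tuple_measureS//=; last 2 first.
- by apply/measurable_EFinP; exact: measurable_fun_prod_tnth.
- exact: (fp0 _ id).
transitivity (\int[mu]_x ((f ord0 x)%:E * (\prod_(i < n) c (lift ord0 i))%:E))%E.
  apply: eq_integral => x _.
  rewrite -(IH (fun i => f (lift ord0 i)) (fun i => c (lift ord0 i)))//
      -ge0_integralZl//=.
  - apply: eq_integral => t _.
    rewrite big_ord_recl tnth0 EFinM; congr (_ * (_)%:E)%E.
    by apply: eq_bigr => i _; rewrite tnthS.
  - apply/measurable_EFinP.
    exact: (@measurable_fun_prod_tnth _ (fun i => f (lift ord0 i))).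
  - by move=> t _; exact: (fp0 _ (lift ord0)).
  - by rewrite lee_fin.
rewrite ge0_integralZr//=.
- by rewrite fc -EFinM big_ord_recl.
- exact/measurable_EFinP.
- by move=> x _; rewrite lee_fin.
rewrite lee_fin prodr_ge0// => i _; rewrite -lee_fin -fc.
by apply: integral_ge0 => x _; rewrite lee_fin.
Qed.

End tuple_measure_theory.

(** Boxes with an arbitrary measurable first side: the pi-system on which the
    joint law of the past and of a batch is known. *)
Definition tuple_boxes dZ (Z : measurableType dZ) d (T : measurableType d) n :
    set (set (Z * n.-tuple T)) :=
  [set X | exists F (E : 'I_n -> set T),
    [/\ measurable F, forall i, measurable (E i) &
        X = F `*` [set t | forall i, E i (tnth t i)]]].

(** The identity from the sigma-algebra generated by the boxes is measurable,
    because each coordinate is. *)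
Lemma tuple_boxesE dZ (Z : measurableType dZ) d (T : measurableType d) n :
  measurable = <<s @tuple_boxes _ Z _ T n >>.
Proof.
apply/seteqP; split=> [A mA|]; last first.
  apply: smallest_sub; first exact: sigma_algebra_measurable.
  move=> _ [F [E [mF mE ->]]]; apply: measurableX => //.
  rewrite (_ : [set t | _] = \bigcap_(i in [set: 'I_n])
                              (@tnth n T ^~ i) @^-1` E i); last first.
    by apply/seteqP; split=> t /= h i; [move=> _; exact: h|exact: h].
  apply: fin_bigcap_measurable => // i _.
  by rewrite -[X in measurable X]setTI; exact: (@measurable_tnth _ T n i).
pose Z' := g_sigma_algebraType (@tuple_boxes _ Z _ T n).
have : measurable_fun setT (fun x : Z' => (x.1, x.2) : Z * n.-tuple T).
  apply/measurable_fun_pairP; split=> /=.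
    move=> _ B mB; rewrite setTI; apply: sub_sigma_algebra.
    exists B, (fun=> setT); split=> //.
    by apply/seteqP; split=> x /=; tauto.
  apply/measurable_fun_tnthP => i _ B mB; rewrite setTI.
  apply: sub_sigma_algebra.
  exists setT, (fun j => if j == i then B else setT); split=> //.
    by move=> j; case: ifP.
  apply/seteqP; split=> x /=.
    by move=> Bx; split=> // j; case: eqP => [->|].
  by move=> [_ /(_ i)]; rewrite eqxx.
move=> /(_ measurableT A mA); rewrite setTI.
by rewrite (_ : _ @^-1` A = A)//; apply/seteqP; split=> -[].
Qed.

Lemma setI_closed_tuple_boxes dZ (Z : measurableType dZ) d
  (T : measurableType d) n : setI_closed (@tuple_boxes _ Z _ T n).
Proof.
move=> _ _ [F [E [mF mE ->]]] [F' [E' [mF' mE' ->]]].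
exists (F `&` F'), (fun i => E i `&` E' i); split.
- exact: measurableI.
- by move=> i; exact: measurableI.
apply/seteqP; split=> x /=.
  by move=> [[? h] [? h']]; do 2 split=> //.
by move=> [[? ?] h]; split; split=> // i; have [] := h i.
Qed.

(** * Sums of independent centered variables *)

Section second_moment.
Context d (T : measurableType d) (R : realType).
Context (mu : {sigma_finite_measure set T -> \bar R}).
Context (p : T -> R).
Hypotheses (mp : measurable_fun setT p) (p0 : forall t, 0 <= p t).
Hypothesis p1 : (\int[mu]_t (p t)%:E = 1)%E.
Context (X : T -> R) (V : R).
Hypothesis mX : measurable_fun setT X.
Hypothesis ipX : mu.-integrable setT (fun t => (p t * X t)%:E).
Hypothesis pX0 : (\int[mu]_t (p t * X t)%:E = 0)%E.
Hypothesis pXX : (\int[mu]_t (p t * X t ^+ 2)%:E = V%:E)%E.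

Lemma integral_sqr_affine y a :
  (\int[mu]_t (p t * (y + a * X t) ^+ 2)%:E = (y ^+ 2 + a ^+ 2 * V)%:E)%E.
Proof.
have ip : mu.-integrable setT (fun t => (p t)%:E).
  apply/integrableP; split; first exact/measurable_EFinP.
  under eq_integral => t _ do rewrite gee0_abs ?lee_fin//.
  by rewrite p1 ltry.
have ipXX : mu.-integrable setT (fun t => (p t * X t ^+ 2)%:E).
  apply/integrableP; split.
    by apply/measurable_EFinP; apply: measurable_funM => //; exact: measurable_funX.
  under eq_integral => t _.
    rewrite gee0_abs ?lee_fin; last by rewrite mulr_ge0// sqr_ge0.
    over.
  by rewrite pXX ltry.
transitivity (\int[mu]_t ((y ^+ 2)%:E * (p t)%:E + ((2 * y * a)%:E *
   (p t * X t)%:E + (a ^+ 2)%:E * (p t * X t ^+ 2)%:E)))%E.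
  apply: eq_integral => t _; rewrite -!EFinM -!EFinD; congr (_%:E); ring.
rewrite integralD//; last 2 first.
- exact: integrableZl.
- by apply: integrableD => //; exact: integrableZl.
rewrite integralD//; last 2 first.
- exact: integrableZl.
- exact: integrableZl.
rewrite !integralZl// p1 pX0 pXX mule0 add0e mule1.
by rewrite -EFinM -EFinD.
Qed.

(** The variance of a sum of independent centered variables, displaced by y. The
    induction integrates over one coordinate at a time a square that the others
    have displaced, so that only nonnegative functions are integrated over tuples
    and cross terms between coordinates never appear. *)
Lemma integral_tuple_sqr_sum n (a : nat -> R) y :
  (\int[tuple_measure mu n]_t ((\prod_(i < n) p (tnth t i)) *
      (y + \sum_(i < n) a i * X (tnth t i)) ^+ 2)%:E =
   (y ^+ 2 + (\sum_(i < n) a i ^+ 2) * V)%:E)%E.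
Proof.
have V0 : 0 <= V.
  rewrite -lee_fin -pXX; apply: integral_ge0 => t _.
  by rewrite lee_fin mulr_ge0// sqr_ge0.
have mF k (b : nat -> R) z : measurable_fun setT (fun t : k.-tuple T =>
    (\prod_(i < k) p (tnth t i)) *
      (z + \sum_(i < k) b i * X (tnth t i)) ^+ 2).
  apply: measurable_funM.
    exact: (@measurable_fun_prod_tnth _ _ _ _ (fun=> p)).
  apply: measurable_funX; apply: measurable_funD => //.
  apply: measurable_sum => i; apply: measurable_funM => //.
  by apply: measurableT_comp => //; exact: measurable_tnth.
have F0 k (b : nat -> R) z (t : k.-tuple T) :
    0 <= (\prod_(i < k) p (tnth t i)) *
      (z + \sum_(i < k) b i * X (tnth t i)) ^+ 2.
  by rewrite mulr_ge0 ?sqr_ge0 ?prodr_ge0.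
elim: n a y => [|n IH] a y.
  rewrite integral_tuple_measure0; last first.
    by apply/measurable_EFinP; exact: (mF 0%N a y).
  by rewrite !big_ord0 mul1r mul0r !addr0.
rewrite ge0_integral_tuple_measureS//=; last 2 first.
- by apply/measurable_EFinP; exact: (mF n.+1 a y).
- by move=> t; rewrite lee_fin; exact: (F0 n.+1 a y).
set V' := (\sum_(i < n) a i.+1 ^+ 2) * V.
have V'0 : 0 <= V' by rewrite mulr_ge0// sumr_ge0// => i _; exact: sqr_ge0.
transitivity (\int[mu]_x ((p x * (y + a 0%N * X x) ^+ 2)%:E +
                          V'%:E * (p x)%:E))%E.
  apply: eq_integral => x _.
  transitivity ((p x)%:E * ((y + a 0%N * X x) ^+ 2 + V')%:E)%E; last first.
    by rewrite -!EFinM -EFinD; congr (_%:E); ring.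
  rewrite -(IH (fun i => a i.+1)) -ge0_integralZl//=.
  - apply: eq_integral => t _.
    rewrite -EFinM big_ord_recl tnth0 -mulrA; congr ((_ * (_ * _ ^+ 2))%:E).
      by apply: eq_bigr => i _; rewrite tnthS.
    rewrite big_ord_recl tnth0 addrA; congr (_ + _).
    by apply: eq_bigr => i _; rewrite tnthS.
  - by apply/measurable_EFinP; exact: (mF n (fun i => a i.+1)).
  - by move=> t _; rewrite lee_fin; exact: (F0 n (fun i => a i.+1)).
  - by rewrite lee_fin.
rewrite ge0_integralD//=; last 4 first.
- by move=> t _; rewrite lee_fin mulr_ge0// sqr_ge0.
- apply/measurable_EFinP; apply: measurable_funM => //.
  by apply: measurable_funX; apply: measurable_funD => //; apply: measurable_funM.
- by move=> t _; rewrite mule_ge0 ?lee_fin.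
- by apply: emeasurable_funM => //; exact/measurable_EFinP.
rewrite integral_sqr_affine ge0_integralZl//=; last 2 first.
- exact/measurable_EFinP.
- by move=> t _; rewrite lee_fin.
by rewrite p1 mule1 -EFinD big_ord_recl /V' mulrDl addrA.
Qed.

End second_moment.

(** * Integration over fresh draws with the past frozen *)

Section freezing.
Context d (Omega : measurableType d) (R : realType) (P : probability Omega R).
Context (G : set (set Omega)).
Local Notation Z := (g_sigma_algebraType G).
Hypothesis mG : G `<=` measurable.

Let mid : measurable_fun setT (id : Omega -> Z).
Proof.
move=> _ A GA; rewrite setTI preimage_id.
by move: A GA; apply: smallest_sub => //; exact: sigma_algebra_measurable.
Qed.

Let idZ : {mfun Omega >-> Z} :=
  HB.pack (id : Omega -> Z) (isMeasurableFun.Build _ _ _ _ _ mid).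

(* Seen on the coarser sigma-algebra generated by G, P is its image by the
   identity. *)
Let PZ : probability Z R := distribution P idZ.

Lemma sub_sigma_measurable_fun d' (U : measurableType d') (f : Z -> U) :
  measurable_fun setT f -> measurable_fun setT (f : Omega -> U).
Proof. by move=> mf; exact: (measurableT_comp mf mid). Qed.

Let ge0_integral_PZ (D : set Z) (f : Z -> \bar R) :
  measurable D -> measurable_fun D f -> (forall z, (0 <= f z)%E) ->
  (\int[PZ]_(z in D) f z = \int[P]_(w in (D : set Omega)) f w)%E.
Proof.
move=> mD mf f0.
have := @ge0_integral_pushforward _ _ _ _ _ _ mid P D f mD mf.
by rewrite preimage_id; apply => y _; exact: f0.
Qed.

(** An event that is independent of the sigma-algebra generated by G factors out
    of integrals of functions measurable for it. *)
Lemma ge0_integral_indep (D : set Omega) (c : R) (h : Omega -> \bar R) :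
  measurable D -> 0 <= c ->
  (forall F, <<s G >> F -> P (F `&` D) = (P F * c%:E)%E) ->
  measurable_fun setT (h : Z -> \bar R) -> (forall w, (0 <= h w)%E) ->
  (\int[P]_w ((\1_D w)%:E * h w) = c%:E * \int[P]_w h w)%E.
Proof.
move=> mD c0 PD mh h0.
have mD1 : measurable_fun setT (\1_D : Omega -> R) by exact: measurable_indic.
have densE (D10 : forall w, 0 <= (\1_D w : R)) F : measurable F ->
    density P mD1 D10 F = P (D `&` F).
  by move=> mF; rewrite -(integral_indic P mF mD).
have D10 w : 0 <= (\1_D w : R) by [].
rewrite -(ge0_integral_density P mD1 D10 (sub_sigma_measurable_fun mh) h0).
have PZh : (\int[PZ]_z h z = \int[P]_w h w)%E by rewrite ge0_integral_PZ.
rewrite -PZh -ge0_integralZl//.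
apply: (@ge0_integral_law _ _ _ Z R (density P mD1 D10) PZ (cst c) measurable id h)
    => //.
- by rewrite sigma_algebra_id//; exact: sigma_algebra_measurable.
- by move=> ? ?; exact: measurableI.
- apply: (@le_lt_trans _ _ (P D)); last first.
    exact: (le_lt_trans (probability_le1 P mD) (ltry _)).
  by have := densE D10 setT measurableT; rewrite setIT => h'; exact: (eq_ind_r (fun x
      => (x <= P D)%E) (lexx _) h').
move=> F mF; rewrite preimage_id; have mF' : measurable (F : set Omega).
  by rewrite -[X in measurable X]setTI; exact: (mid measurableT mF).
transitivity (P (D `&` F)); first exact: densE.
by rewrite setIC PD// muleC; apply/esym; exact: (integral_cst PZ mF c%:E).
Qed.

Context d' (T : measurableType d') (mu : {sigma_finite_measure set T -> \bar R}).
Context (n : nat) (X : nat -> Omega -> T) (q : Omega -> T -> R).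
Hypothesis mX : forall i, measurable_fun setT (X i).
Hypothesis mq : measurable_fun setT (fun x : Z * T => q x.1 x.2).
Hypothesis q0 : forall w t, 0 <= q w t.
Hypothesis q1 : forall w, (\int[mu]_t (q w t)%:E = 1)%E.
Hypothesis Xq : forall (E : 'I_n -> set T) (F : set Omega),
  (forall i, measurable (E i)) -> <<s G >> F ->
  P (F `&` [set w | forall i : 'I_n, E i (X i w)]) =
  (\int[P]_(w in F)
     (\prod_(i < n) fine (\int[mu]_(t in E i) (q w t)%:E))%:E)%E.

Let Q (z : Z * n.-tuple T) : R := \prod_(i < n) q z.1 (tnth z.2 i).

Let mqw w : measurable_fun setT (q w).
Proof. exact: (measurableT_comp mq (measurable_pair1 (w : Z))). Qed.

Let mtnth i : measurable_fun setT (fun z : Z * n.-tuple T => tnth z.2 i).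
Proof. exact: (measurableT_comp (measurable_tnth i)). Qed.

Let mqt i : measurable_fun setT (fun z : Z * n.-tuple T => q z.1 (tnth z.2 i)).
Proof.
have h : measurable_fun setT (fun z : Z * n.-tuple T => (z.1, tnth z.2 i)).
  by apply/measurable_fun_pairP; split; [exact: measurable_fst|exact: (mtnth i)].
exact: (measurableT_comp mq h).
Qed.

Let mQ : measurable_fun setT Q.
Proof.
apply: (measurable_prod (h := fun i (z : Z * n.-tuple T) =>
  q z.1 (tnth z.2 i))) => i _.
exact: mqt.
Qed.

Let Q0 z : 0 <= Q z. Proof. exact: prodr_ge0. Qed.

Let f w : Z * n.-tuple T := (w, [tuple X i w | i < n]).

Let mf : measurable_fun setT f.
Proof.
apply/measurable_fun_pairP; split => //=.
apply/measurable_fun_tnthP => i /=.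
by rewrite (_ : _ \o _ = X i)//; apply/funext => w /=; rewrite tnth_mktuple.
Qed.

Let c (E : 'I_n -> set T) i w := fine (\int[mu]_(t in E i) (q w t)%:E).

Let integral_cE (E : 'I_n -> set T) i w : measurable (E i) ->
  (\int[mu]_t (q w t * \1_(E i) t)%:E = (c E i w)%:E)%E.
Proof.
move=> mE; rewrite /c fineK.
  rewrite [RHS]integral_mkcond; apply: eq_integral => t _.
  by rewrite patchE indicE; case: ifP => _; rewrite ?mulr1 ?mulr0.
rewrite ge0_fin_numE; last by apply: integral_ge0 => t _; rewrite lee_fin.
apply: (@le_lt_trans _ _ 1%E); last exact: ltry.
rewrite -(q1 w); apply: ge0_subset_integral => //.
- exact/measurable_EFinP.
- by move=> t _; rewrite lee_fin.
Qed.

(** With the sigma-algebra generated by G as the past, X 0, ..., X n.-1 are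
    conditionally i.i.d. of density q, which may depend on the past. Both sides
    integrate h, one for the joint law of past and draws, the other for the
    measure of density Q with respect to a product; they agree on boxes by
    hypothesis, hence everywhere. *)
Lemma ge0_integral_freezing (h : Omega -> n.-tuple T -> \bar R) :
  measurable_fun setT (fun z : Z * n.-tuple T => h z.1 z.2) ->
  (forall w t, (0 <= h w t)%E) ->
  (\int[P]_w h w [tuple X i w | i < n] =
   \int[P]_w \int[tuple_measure mu n]_t
      ((\prod_(i < n) q w (tnth t i))%:E * h w t))%E.
Proof.
move=> mh h0; pose mt := tuple_measure mu n.
have mQh : measurable_fun setT (fun z : Z * n.-tuple T => (Q z)%:E * h z.1 z.2)%E.
  by apply: emeasurable_funM => //; exact/measurable_EFinP.
have Qh0 z : (0 <= (Q z)%:E * h z.1 z.2)%E by rewrite mule_ge0 ?lee_fin.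
transitivity (\int[prodm PZ mt]_z ((Q z)%:E * h z.1 z.2))%E; last first.
  rewrite /prodm (fubini_tonelli1 (fun z => (Q z)%:E * h z.1 z.2)%E)//.
  rewrite ge0_integral_PZ//.
  - exact: (measurable_fun_fubini_tonelli_F (m2 := mt) _ mQh Qh0).
  - by move=> z; apply: integral_ge0 => t _; exact: Qh0.
apply: (ge0_integral_law (G := @tuple_boxes _ Z _ T n) (f := f)
  (h := fun z => h z.1 z.2)) => //.
- exact: tuple_boxesE.
- exact: setI_closed_tuple_boxes.
- exists setT, (fun=> setT); split => //.
  by apply/seteqP; split=> x.
- exact: (le_lt_trans (probability_le1 P measurableT) (ltry _)).
move=> _ [F [E [mF mE ->]]].
have mFE : measurable (F `*` [set t | forall i, E i (tnth t i)]).
  by rewrite tuple_boxesE; apply: sub_sigma_algebra; exists F, E.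
rewrite (_ : f @^-1` _ = F `&` [set w | forall i : 'I_n, E i (X i w)]); last first.
  apply/seteqP; split=> w /=.
    by move=> [? h']; split => // i; have := h' i; rewrite tnth_mktuple.
  by move=> [? h']; split => // i; rewrite tnth_mktuple.
transitivity (\int[P]_(w in F) (\prod_(i < n) c E i w)%:E)%E; first exact: Xq.
pose q' (z : Z * n.-tuple T) := \1_F z.1 * \prod_(i < n) (q z.1 (tnth z.2 i) * \1_(E
    i) (tnth z.2 i)).
have q'0 z : 0 <= q' z by rewrite mulr_ge0// prodr_ge0// => i _; rewrite mulr_ge0.
have mq' : measurable_fun setT q'.
  apply: measurable_funM.
    exact: (measurableT_comp (@measurable_indic _ _ _ setT F mF)).
  apply: measurable_prod => i _; apply: measurable_funM => //.
  exact: (measurableT_comp (@measurable_indic _ _ _ setT (E i) (mE i)) (mtnth i)).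
rewrite [RHS]integral_mkcond.
transitivity (\int[prodm PZ mt]_z (q' z)%:E)%E; last first.
  apply: eq_integral => -[w t] _; rewrite patchE; case: ifPn => [|].
    rewrite inE => -[/= Fw Et]; rewrite /q' /= indicE mem_set// mul1r.
    congr (_%:E); apply: eq_bigr => i _; by rewrite indicE mem_set ?mulr1.
  move/negP; rewrite inE => nFE; apply/eqP; rewrite /q' eqe /=.
  rewrite mulf_eq0 indicE; case: (boolP (w \in F)) => [|_]; last by rewrite eqxx.
  rewrite inE => Fw; apply/orP; right.
  have /existsNP[i nEi] : ~ forall i, E i (tnth t i).
    by move=> Et; apply: nFE.
  by rewrite (bigD1 i)//= indicE memNset// mulr0 mul0r eqxx.
rewrite /prodm (fubini_tonelli1 (fun z => (q' z)%:E))//; last first.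
  exact/measurable_EFinP.
rewrite /fubini_F /=.
transitivity (\int[PZ]_w ((\prod_(i < n) c E i w)%:E * (\1_F w)%:E))%E; last first.
  apply: eq_integral => w _; rewrite /q' /=.
  rewrite -(@integral_tuple_prod _ _ _ mu n (fun i t => q w t * \1_(E i) t)
    (fun i => c E i w)).
  - rewrite muleC -ge0_integralZl//=.
    + apply/measurable_EFinP.
      apply: (@measurable_fun_prod_tnth _ _ _ _ (fun i t => q w t * \1_(E i) t)).
      by move=> i; apply: measurable_funM => //; exact: measurable_indic.
    + by move=> t _; rewrite lee_fin prodr_ge0// => i _; rewrite mulr_ge0.
  - by move=> i; apply: measurable_funM => //; exact: measurable_indic.
  - by move=> i t; rewrite mulr_ge0.
  - by move=> i; exact: integral_cE.
have mc i : measurable_fun setT (c E i : Z -> R).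
  apply/measurable_EFinP.
  rewrite (_ : EFin \o _ = fun w => \int[mu]_t (q w t * \1_(E i) t)%:E)%E; last first.
    by apply/funext => w /=; rewrite integral_cE.
  apply: (measurable_fun_fubini_tonelli_F (m2 := mu)
    (fun z : Z * T => (q z.1 z.2 * \1_(E i) z.2)%:E)) => //.
    apply/measurable_EFinP; apply: measurable_funM => //.
    exact: (measurableT_comp (@measurable_indic _ _ _ setT (E i) (mE i))).
  by move=> z; rewrite lee_fin mulr_ge0.
have cp0 w : 0 <= \prod_(i < n) c E i w.
  by apply: prodr_ge0 => i _; apply: fine_ge0; apply: integral_ge0 => t _; rewrite
      lee_fin.
have mcp : measurable_fun setT (fun w : Z => (\prod_(i < n) c E i w)%:E).
  by apply/measurable_EFinP; exact: measurable_prod.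
rewrite -ge0_integral_PZ//; last exact: measurable_funTS.
rewrite [LHS]integral_mkcond; apply: eq_integral => w _.
by rewrite patchE indicE; case: ifP => _; rewrite ?mule1 ?mule0.
Qed.

End freezing.

(** * Joint measurability in a parameter and a sample *)

Lemma normr_coord_le (R : realType) d (x : 'rV[R]_d) i : `|x 0 i| <= `|x|.
Proof.
rewrite [leRHS]/Num.norm /= mx_normrE; apply/bigmax_geP; right.
by exists (0, i).
Qed.

Lemma normr_rV_le (R : realType) d (x : 'rV[R]_d) (e : R) :
  0 <= e -> (forall i, `|x 0 i| <= e) -> `|x| <= e.
Proof.
move=> e0 xe; rewrite [leLHS]/Num.norm /= mx_normrE; apply/bigmax_leP; split => //.
by move=> [j i] _ /=; rewrite ord1.
Qed.

Lemma continuous_lipschitz_l1 (R : realType) d (f : 'rV[R]_d -> R) (C : R) :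
  (forall x y, `|f x - f y| <= C * \sum_(i < d) `|x 0 i - y 0 i|) ->
  continuous f.
Proof.
move=> fC x; apply/(@cvgrPdist_lt _ _ _ (nbhs x) (nbhs_filter x)) => e e0.
have K0 : 0 < (`|C| * d%:R + 1 : R) by rewrite ltr_wpDl// mulr_ge0.
apply/nbhs_ballP; exists (e / (`|C| * d%:R + 1)); first exact: divr_gt0.
move=> y; rewrite -ball_normE /= => xy; apply: le_lt_trans (fC x y) _.
apply: (@le_lt_trans _ _ (`|C| * (d%:R * `|x - y|))).
  apply: (@le_trans _ _ (`|C| * \sum_(i < d) `|x 0 i - y 0 i|)).
    by rewrite ler_wpM2r ?ler_norm ?sumr_ge0.
  rewrite ler_wpM2l//.
  rewrite mulr_natl -[X in _ *+ X]card_ord -sumr_const.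
  apply: ler_sum => i _.
  by apply: le_trans (normr_coord_le (x - y) i); rewrite !mxE.
rewrite mulrA; move: xy; rewrite ltr_pdivlMr// => xy.
apply: le_lt_trans xy; rewrite mulrC ler_wpM2l//; lra.
Qed.

Lemma measurable_fun_floor d (T : measurableType d) (R : realType) (f : T -> R) z :
  measurable_fun setT f -> measurable [set x | Num.floor (f x) = z].
Proof.
move=> mf; rewrite (_ : [set x | _] = setT `&` f @^-1` `[z%:~R, (z + 1)%:~R[%classic).
  exact: mf.
apply/seteqP; split=> x /=.
  by move=> /eqP; rewrite floor_eq in_itv /=.
by rewrite in_itv /= => -[_]; rewrite -floor_eq => /eqP.
Qed.

(** Rounding u w to the grid of mesh 1/n gives countably many values, on each of
    which the function is a measurable function of the sample alone; continuity
    recovers it in the limit. *)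
Lemma measurable_fun_caratheodory dU (U : measurableType dU) dT
    (T : measurableType dT) (R : realType) d (f : 'rV[R]_d -> T -> R)
    (u : U -> 'rV[R]_d) :
  (forall x, measurable_fun setT (f x)) ->
  (forall t, continuous (f ^~ t)) ->
  (forall i, measurable_fun setT (fun w => u w 0 i)) ->
  measurable_fun setT (fun z : U * T => f (u z.1) z.2).
Proof.
move=> mf cf mu.
pose N (n : nat) : R := n.+1%:R.
have N0 n : 0 < N n by rewrite ltr0n.
pose F n w : 'rV[int]_d := \row_i Num.floor (N n * u w 0 i).
pose pt n (z : 'rV[int]_d) : 'rV[R]_d := \row_i ((z 0 i)%:~R / N n).
have ptF n w : `|u w - pt n (F n w)| <= (N n)^-1.
  apply: normr_rV_le; first by rewrite invr_ge0 ltW.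
  move=> i; rewrite !mxE; have /andP[h1 h2] := floor_itv (N n * u w 0 i).
  rewrite -(ler_pM2l (N0 n)) divff ?gt_eqF// -{1}(gtr0_norm (N0 n)) -normrM.
  rewrite mulrBr mulrCA divff ?gt_eqF// mulr1 ger0_norm ?subr_ge0//.
  by move: h2; rewrite intrD; lra.
apply: (@measurable_fun_cvg _ _ _ _ (fun n (z : U * T) => f (pt n (F n z.1)) z.2)).
  move=> n _ Y mY; rewrite setTI.
  rewrite (_ : _ @^-1` Y = \bigcup_(z in [set: 'rV[int]_d])
     ([set w | F n w = z] `*` (f (pt n z) @^-1` Y))); last first.
    apply/seteqP; split=> [[w t] /= Yf|[w t] [z _ [/= <-]]]; last by [].
    by exists (F n w).
  apply: countable_bigcupT_measurable; first exact: countableP.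
  move=> z; apply: measurableX; last by rewrite -[X in measurable X]setTI; exact: mf.
  rewrite (_ : [set w | _] = \bigcap_(i in [set: 'I_d])
    [set w | Num.floor (N n * u w 0 i) = z 0 i]).
    apply: fin_bigcap_measurable => // i _; apply: measurable_fun_floor.
    exact: measurable_funM.
  apply/seteqP; split=> w /=.
    by move=> <- i _; rewrite /= mxE.
  by move=> h; apply/rowP => i; rewrite mxE; exact: h.
move=> [w t] _ /=.
have ptu : pt n (F n w) @[n --> \oo] --> u w.
  apply/cvgrPdist_lt => e e0; near=> n; apply: le_lt_trans (ptF n w) _.
  by near: n; exact: (near_infty_natSinv_lt (PosNum e0)).
exact: (cvg_comp (fun n => pt n (F n w)) (f ^~ t) ptu (cf t (u w))).
Unshelve. all: by end_near. Qed.
(** * Functions with bounded partial derivatives *)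

Lemma is_derive_line (R : realType) d (f : 'rV[R]_d -> R) (x u : 'rV[R]_d) t :
  derivable f (x + t *: u) u ->
  is_derive t 1 (fun s : R => f (x + s *: u)) ('D_u f (x + t *: u)).
Proof.
move=> df.
pose g1 := fun h : R => h^-1 *: (((fun s : R => f (x + s *: u)) \o shift t) (h *: 1)
    - f (x + t *: u)).
pose g2 := fun h : R => h^-1 *: ((f \o shift (x + t *: u)) (h *: u) - f (x + t *: u)).
have g12 : g1 = g2.
  apply/funext => h; rewrite /g1 /g2 /=; congr (_ *: (f _ - _)).
  by rewrite scaler1 scalerDl addrCA.
split; first by rewrite /derivable -/g1 g12.
by rewrite /derive -/g1 g12.
Qed.

(** The mean value theorem along one axis after the other. *)
Lemma lipschitz_partial (R : realType) d (f : 'rV[R]_d -> R) (C : R) :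
  (forall x i, derivable f x (delta_mx 0 i)) ->
  (forall x i, `|partial i f x| <= C) ->
  forall x y, `|f x - f y| <= C * \sum_(i < d) `|x 0 i - y 0 i|.
Proof.
move=> df fC.
have line x i (a b : R) : a <= b ->
    `|f (x + b *: delta_mx 0 i) - f (x + a *: delta_mx 0 i)| <= C * (b - a).
  move=> ab.
  have dline (s : R) := is_derive_line (df (x + s *: delta_mx 0 i) i).
  have cline : {within `[a, b], continuous (fun s : R => f (x + s *: delta_mx 0 i))}.
    by apply: derivable_within_continuous => s _; have [] := dline s.
  have [c _ ->] := MVT_segment ab (fun s _ => dline s) cline.
  by rewrite normrM (ger0_norm (_ : 0 <= b - a)) ?subr_ge0// ler_wpM2r ?subr_ge0//;
      exact: fC.
have step x i (c : R) : `|f (x + c *: delta_mx 0 i) - f x| <= C * `|c|.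
  have [c0|c0] := leP 0 c.
    by have := line x i _ _ c0; rewrite scale0r addr0 subr0 (ger0_norm c0).
  have := line x i _ _ (ltW c0).
  by rewrite scale0r addr0 sub0r distrC (ltr0_norm c0).
have sum (s : seq 'I_d) (c : 'I_d -> R) x :
    `|f (x + \sum_(i <- s) c i *: delta_mx 0 i) - f x| <=
    C * \sum_(i <- s) `|c i|.
  elim: s x => [|i s IH] x; first by rewrite !big_nil addr0 subrr normr0 mulr0.
  rewrite !big_cons mulrDr addrA.
  rewrite -(subrKA (f (x + c i *: delta_mx 0 i))) [leRHS]addrC.
  by apply: le_trans (ler_normD _ _) _; rewrite lerD ?step ?IH.
move=> x y; have := sum (index_enum _) (fun i => (x - y) 0 i) y.
rewrite -row_sum_delta (addrC y) subrK.
by under eq_bigr do rewrite !mxE.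
Qed.

Lemma continuous_mul (R : realType) (V : topologicalType) (f g : V -> R) :
  continuous f -> continuous g -> continuous (fun x => f x * g x).
Proof. by move=> cf cg x; exact: (cvgM (cf x) (cg x)). Qed.

(** * The density of a trajectory *)

Section trajectory_density.
Context (R : realType) (dS dA : measure_display).
Context (S : measurableType dS) (A : measurableType dA) (M : mdp R S A).
Context (d H : nat) (pi : 'rV[R]_d -> S -> A -> R).
Hypothesis ppi : is_policy M pi.

Local Notation muSA := (prodm (state_measure M) (action_measure M)).
Local Notation traj := (H.-tuple (S * A)%type).

Lemma next_pdf_ge0 theta s a l : 0 <= next_pdf M pi theta s a l.
Proof.
elim: l s a => [|[s' a'] l IH] s a //=.
by rewrite !mulr_ge0 ?trans_ge0 ?(policy_ge0 ppi).
Qed.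

Lemma traj_pdf_ge0 theta (tau : traj) : 0 <= traj_pdf M pi theta tau.
Proof.
rewrite /traj_pdf; case: (tval tau) => [|[s a] l] //.
by rewrite !mulr_ge0 ?init_ge0 ?(policy_ge0 ppi)// next_pdf_ge0.
Qed.

Lemma measurable_next_pdf theta n :
  measurable_fun setT (fun x : (S * A) * n.-tuple (S * A) =>
    next_pdf M pi theta x.1.1 x.1.2 x.2).
Proof.
elim: n => [|n IH].
  rewrite (_ : (fun _ => _) = cst 1)//.
  by apply/funext => -[x t]; rewrite (tuple0 t).
have mhd : measurable_fun setT (fun x : (S * A) * n.+1.-tuple (S * A) => thead x.2).
  exact: (measurableT_comp (measurable_tnth ord0)).
have mbh : measurable_fun setT (fun x : (S * A) * n.+1.-tuple (S * A) =>
    [tuple of behead x.2]).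
  exact: (measurableT_comp (@measurable_behead _ _ n)).
rewrite (_ : (fun _ => _) = fun x : (S * A) * n.+1.-tuple (S * A) =>
   trans M x.1.1 x.1.2 (thead x.2).1 * pi theta (thead x.2).1 (thead x.2).2 *
   next_pdf M pi theta (thead x.2).1 (thead x.2).2 [tuple of behead x.2]); last first.
  by apply/funext => -[x t]; case/tupleP: t => -[s a] t.
apply: measurable_funM; first apply: measurable_funM.
- have h : measurable_fun setT (fun x : (S * A) * n.+1.-tuple (S * A) =>
      (x.1.1, x.1.2, (thead x.2).1)).
    apply/measurable_fun_pairP; split.
      apply/measurable_fun_pairP; split.
        exact: (measurableT_comp measurable_fst measurable_fst).
      exact: (measurableT_comp measurable_snd measurable_fst).
    exact: (measurableT_comp measurable_fst mhd).
  exact: (measurableT_comp (measurable_trans M) h).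
- exact: (measurableT_comp (measurable_policy ppi theta) mhd).
- have h : measurable_fun setT (fun x : (S * A) * n.+1.-tuple (S * A) =>
      (thead x.2, [tuple of behead x.2])).
    by apply/measurable_fun_pairP; split.
  exact: (measurableT_comp IH h).
Qed.

Lemma integral_next_pdf theta n s a :
  (\int[tuple_measure muSA n]_t (next_pdf M pi theta s a t)%:E = 1)%E.
Proof.
have mn k s' a' : measurable_fun setT (fun t : k.-tuple (S * A) =>
    next_pdf M pi theta s' a' t).
  have h : measurable_fun setT (fun t : k.-tuple (S * A) => ((s', a'), t)).
    by apply/measurable_fun_pairP; split; [exact: measurable_cst|exact: measurable_id].
  exact: (measurableT_comp (@measurable_next_pdf theta k) h).
elim: n s a => [|n IH] s a.
  rewrite integral_tuple_measure0//.
  by apply/measurable_EFinP; exact: (mn 0%N s a).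
rewrite ge0_integral_tuple_measureS; last 2 first.
- by apply/measurable_EFinP; exact: (mn n.+1 s a).
- by move=> t; rewrite lee_fin next_pdf_ge0.
have tp0 x : 0 <= trans M s a x.1 * pi theta x.1 x.2.
  by rewrite mulr_ge0 ?trans_ge0 ?(policy_ge0 ppi).
have mt : measurable_fun setT (trans M s a).
  exact: (measurableT_comp (measurable_trans M) (measurable_pair1 (s, a))).
have mtp : measurable_fun setT (fun x => trans M s a x.1 * pi theta x.1 x.2).
  apply: measurable_funM; last exact: (measurable_policy ppi theta).
  exact: (measurableT_comp mt measurable_fst).
transitivity (\int[muSA]_x (trans M s a x.1 * pi theta x.1 x.2)%:E)%E.
  apply: eq_integral => -[s' a'] _ /=.
  under eq_integral do rewrite EFinM.
  rewrite ge0_integralZl//=.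
  - by rewrite IH mule1.
  - by apply/measurable_EFinP; exact: (mn n s' a').
  - by move=> t _; rewrite lee_fin next_pdf_ge0.
  - by rewrite lee_fin (tp0 (s', a')).
rewrite /prodm (fubini_tonelli1 (fun x => (trans M s a x.1 * pi theta x.1 x.2)%:E))//.
- rewrite -(trans1 M s a); apply: eq_integral => s' _; rewrite /fubini_F /=.
  under eq_integral do rewrite EFinM.
  rewrite ge0_integralZl//=.
  - by rewrite (policy1 ppi) mule1.
  - apply/measurable_EFinP.
    exact: (measurableT_comp (measurable_policy ppi theta) (measurable_pair1 s')).
  - by move=> t _; rewrite lee_fin (policy_ge0 ppi).
  - by rewrite lee_fin trans_ge0.
- exact/measurable_EFinP.
Qed.

Lemma measurable_traj_pdf theta : measurable_fun setT (traj_pdf M pi theta : traj -> R).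
Proof.
case: H => [|n].
  rewrite (_ : traj_pdf _ _ _ = cst 1)//.
  by apply/funext => t; rewrite (tuple0 t).
have mhd : measurable_fun setT (@thead n (S * A)%type).
  exact: (measurable_tnth ord0).
have mbh := @measurable_behead _ (S * A)%type n.
rewrite (_ : traj_pdf _ _ _ = fun x : n.+1.-tuple (S * A) =>
   init M (thead x).1 * pi theta (thead x).1 (thead x).2 *
   next_pdf M pi theta (thead x).1 (thead x).2 [tuple of behead x]); last first.
  by apply/funext => t; case/tupleP: t => -[s a] t.
apply: measurable_funM; first apply: measurable_funM.
- exact: (measurableT_comp (measurable_init M) (measurableT_comp measurable_fst mhd)).
- exact: (measurableT_comp (measurable_policy ppi theta) mhd).
- have h : measurable_fun setT (fun x : n.+1.-tuple (S * A) =>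
      (thead x, [tuple of behead x])).
    by apply/measurable_fun_pairP; split.
  exact: (measurableT_comp (@measurable_next_pdf theta n) h).
Qed.

Lemma integral_traj_pdf theta :
  (\int[traj_measure M H]_t (traj_pdf M pi theta t)%:E = 1)%E.
Proof.
have mp := measurable_traj_pdf theta; have p0 := @traj_pdf_ge0 theta.
rewrite /traj_measure; case: H mp p0 => [|n] mp p0.
  rewrite integral_tuple_measure0//.
  by apply/measurable_EFinP; exact: mp.
rewrite ge0_integral_tuple_measureS; last 2 first.
- exact/measurable_EFinP.
- by move=> t; rewrite lee_fin p0.
have mip : measurable_fun setT (fun x => init M x.1 * pi theta x.1 x.2).
  apply: measurable_funM; last exact: (measurable_policy ppi theta).
  exact: (measurableT_comp (measurable_init M) measurable_fst).
have ip0 x : 0 <= init M x.1 * pi theta x.1 x.2.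
  by rewrite mulr_ge0 ?init_ge0 ?(policy_ge0 ppi).
transitivity (\int[muSA]_x (init M x.1 * pi theta x.1 x.2)%:E)%E.
  apply: eq_integral => -[s' a'] _ /=.
  rewrite -[RHS]mule1 -(integral_next_pdf theta n s' a') -ge0_integralZl//=.
  - apply/measurable_EFinP.
    have h : measurable_fun setT (fun t : n.-tuple (S * A) => ((s', a'), t)).
      by apply/measurable_fun_pairP; split; [exact: measurable_cst|exact:
          measurable_id].
    exact: (measurableT_comp (@measurable_next_pdf theta n) h).
  - by move=> t _; rewrite lee_fin next_pdf_ge0.
  - by rewrite lee_fin (ip0 (s', a')).
rewrite /prodm (fubini_tonelli1 (fun x => (init M x.1 * pi theta x.1 x.2)%:E))//.
- rewrite -(init1 M); apply: eq_integral => s' _; rewrite /fubini_F /=.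
  under eq_integral do rewrite EFinM.
  rewrite ge0_integralZl//=.
  - by rewrite (policy1 ppi) mule1.
  - apply/measurable_EFinP.
    exact: (measurableT_comp (measurable_policy ppi theta) (measurable_pair1 s')).
  - by move=> t _; rewrite lee_fin (policy_ge0 ppi).
  - by rewrite lee_fin init_ge0.
- exact/measurable_EFinP.
Qed.

Context (G CH Rmax : R).
Hypothesis scores : bounded_scores M pi G CH Rmax.

Lemma policy_gt0 theta s a : 0 < pi theta s a.
Proof. by have [_ _ _ _ /(_ theta s a)[]] := scores. Qed.

(** The scores are the partial derivatives of the logarithm of the policy. *)
Lemma continuous_policy s a : continuous (fun theta => pi theta s a).
Proof.
rewrite (_ : (fun _ => _) = expR \o (fun theta => ln (pi theta s a))); last first.
  by apply/funext => theta /=; rewrite lnK// posrE policy_gt0.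
move=> theta; apply: continuous_comp; last exact: continuous_expR.
apply: (@continuous_lipschitz_l1 _ _ _ G); apply: lipschitz_partial => x i;
  by have [_ _ _ _ /(_ x s a)[_ /(_ i i)[]]] := scores.
Qed.

Lemma continuous_next_pdf s a l : continuous (fun theta => next_pdf M pi theta s a l).
Proof.
elim: l s a => [|[s' a'] l IH] s a /=; first exact: cst_continuous.
apply: continuous_mul; last exact: IH.
by apply: continuous_mul; [exact: cst_continuous|exact: continuous_policy].
Qed.

Lemma continuous_traj_pdf (t : traj) : continuous (fun theta => traj_pdf M pi theta t).
Proof.
rewrite /traj_pdf; case: (tval t) => [|[s a] l]; first exact: cst_continuous.
apply: continuous_mul; last exact: continuous_next_pdf.
by apply: continuous_mul; [exact: cst_continuous|exact: continuous_policy].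
Qed.

(** Policies are positive, so a trajectory of density zero is one that the
    initial distribution or the transition model excludes, whatever the
    parameter. *)
Lemma traj_pdf_eq0 theta theta' (t : traj) :
  traj_pdf M pi theta t = 0 -> traj_pdf M pi theta' t = 0.
Proof.
have next0 s a l : next_pdf M pi theta s a l = 0 -> next_pdf M pi theta' s a l = 0.
  elim: l s a => [|[s' a'] l IH] s a //= /eqP.
  rewrite !mulf_eq0 (gt_eqF (policy_gt0 _ _ _)) orbF.
  by case/orP => /eqP h; [rewrite h !mul0r|rewrite IH// mulr0].
rewrite /traj_pdf; case: (tval t) => [|[s a] l] //= /eqP.
rewrite !mulf_eq0 (gt_eqF (policy_gt0 _ _ _)) orbF.
by case/orP => /eqP h; [rewrite h !mul0r|rewrite next0// mulr0].
Qed.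

(** Absolute continuity makes importance weighting exact, also where the weight
    divides by zero. *)
Lemma traj_pdf_weight theta theta' (t : traj) :
  traj_pdf M pi theta t * weight M pi t theta theta' = traj_pdf M pi theta' t.
Proof.
rewrite /weight; have [p0|pn0] := eqVneq (traj_pdf M pi theta t) 0.
  by rewrite p0 mul0r (traj_pdf_eq0 _ p0).
by rewrite mulrCA divff ?mulr1.
Qed.

End trajectory_density.

(** * The Euclidean norm and smooth ascent *)

Lemma enorm_sqr (R : realType) d (x : 'rV[R]_d) :
  enorm x ^+ 2 = \sum_(i < d) x 0 i ^+ 2.
Proof. by rewrite sqr_sqrtr// sumr_ge0// => i _; exact: sqr_ge0. Qed.

Lemma enormZ_sqr (R : realType) d (a : R) (x : 'rV[R]_d) :
  enorm (a *: x) ^+ 2 = a ^+ 2 * enorm x ^+ 2.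
Proof.
rewrite !enorm_sqr mulr_sumr; apply: eq_bigr => i _.
by rewrite mxE exprMn.
Qed.

Lemma enormD_sqr_le (R : realType) d (x y : 'rV[R]_d) :
  enorm (x + y) ^+ 2 <= 2 * enorm x ^+ 2 + 2 * enorm y ^+ 2.
Proof.
rewrite !enorm_sqr !mulr_sumr -big_split; apply: ler_sum => i _ /=.
rewrite mxE -subr_ge0 [X in 0 <= X](_ : _ = (x 0 i - y 0 i) ^+ 2) ?sqr_ge0//.
ring.
Qed.

Lemma coord_sqr_le_enorm (R : realType) d (x : 'rV[R]_d) i :
  x 0 i ^+ 2 <= enorm x ^+ 2.
Proof.
rewrite enorm_sqr (bigD1 i)//= lerDl.
by apply: sumr_ge0 => j _; exact: sqr_ge0.
Qed.

Lemma enorm_le_l1 (R : realType) d (x : 'rV[R]_d) :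
  enorm x <= \sum_(i < d) `|x 0 i|.
Proof.
have S0 (s : seq 'I_d) : 0 <= \sum_(i <- s) `|x 0 i| by exact: sumr_ge0.
rewrite -(@ler_pXn2r _ 2) ?nnegrE ?sqrtr_ge0 ?S0// enorm_sqr.
elim: (index_enum _) => [|i s IH]; first by rewrite !big_nil expr0n.
rewrite !big_cons sqrrD -normrX ger0_norm ?sqr_ge0// -addrA lerD2l.
by apply: le_trans IH _; rewrite lerDr mulrn_wge0// mulr_ge0.
Qed.

Section ascent.
Context (R : realType) (d : nat) (J : 'rV[R]_d -> R) (L : R).
Hypothesis L0 : 0 < L.
Hypothesis dJ : forall x, differentiable J x.
Hypothesis gradJ_lip : forall x y, enorm (grad J x - grad J y) <= L * enorm (x - y).

Local Notation dot x y := (\sum_(i < d) x 0 i * y 0 i).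

Lemma derive_dot_grad (x u : 'rV[R]_d) : 'D_u J x = dot (grad J x) u.
Proof.
rewrite deriveE// {1}(row_sum_delta u) linear_sum; apply: eq_bigr => i _.
by rewrite linearZ /= mxE /partial deriveE// mulrC.
Qed.

(** The mean value theorem for t |-> J (x + t u) minus the quadratic lower model;
    the derivative is nonnegative by the Lipschitz bound. *)
Lemma smooth_lower_bound (x u : 'rV[R]_d) :
  J x + dot (grad J x) u - L / 2 * enorm u ^+ 2 <= J (x + u).
Proof.
set k := dot (grad J x) u; set b := enorm u ^+ 2.
pose psi (t : R) : R := J (x + t *: u) + (L / 2 * b * t ^+ 2 - k * t).
pose dpsi (t : R) : R := 'D_u J (x + t *: u) + (L * b * t - k).
have dpsiE (t : R) : is_derive t (1 : R) psi (dpsi t).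
  have h1 : is_derive t (1 : R) (fun s : R => J (x + s *: u)) ('D_u J (x + t *: u)).
    by apply: is_derive_line; exact: diff_derivable.
  have h2 : is_derive t (1 : R) (fun s : R => L / 2 * b * s ^+ 2 - k * s) (L * b * t
      - k).
    have h := is_deriveB (is_deriveZ (L / 2 * b) (is_deriveX 2 (is_derive_id t (1 :
        R))))
      (is_deriveZ k (is_derive_id t (1 : R))).
    have -> : (fun s : R => L / 2 * b * s ^+ 2 - k * s) =
        (L / 2 * b) \*: (id ^+ 2) - k \*: id.
      by apply/funext.
    by apply: is_derive_eq h _; rewrite /GRing.scale /=; field.
  exact: is_deriveD.
have cpsi : {within `[0, 1], continuous psi}.
  by apply: derivable_within_continuous => s _; have [] := dpsiE s.
have [c c01] := MVT ltr01 (fun s _ => dpsiE s) cpsi.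
rewrite subr0 mulr1 /psi scale1r scale0r addr0 => psiE.
move: c01; rewrite in_itv /= => /andP[c0 c1].
suff : 0 <= dpsi c by rewrite -psiE; lra.
rewrite /dpsi derive_dot_grad.
set D := grad J (x + c *: u) - grad J x.
have Dk : dot D u = dot (grad J (x + c *: u)) u - k.
  by rewrite /k -sumrB; apply: eq_bigr => i _; rewrite !mxE; ring.
have -> : dot (grad J (x + c *: u)) u + (L * b * c - k) = dot D u + L * b * c.
  by rewrite Dk; ring.
have Db : enorm D ^+ 2 <= (L * c) ^+ 2 * b.
  have := gradJ_lip (x + c *: u) x; rewrite -/D addrC addKr => h.
  apply: (@le_trans _ _ ((L * enorm (c *: u)) ^+ 2)).
    by rewrite ler_pXn2r ?nnegrE ?sqrtr_ge0// mulr_ge0 ?sqrtr_ge0 ?ltW.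
  by rewrite exprMn enormZ_sqr exprMn mulrA.
have Lc : 0 < L * c by rewrite mulr_gt0.
(* Young's inequality for the scalar product; by Db, the weight L c balances
   the two squares. *)
have young : 0 <= enorm D ^+ 2 + 2 * (L * c) * dot D u + (L * c) ^+ 2 * b.
  rewrite /b !enorm_sqr !mulr_sumr -!big_split; apply: sumr_ge0 => i _ /=.
  rewrite [X in 0 <= X](_ : _ = (D 0 i + L * c * u 0 i) ^+ 2) ?sqr_ge0//.
  ring.
rewrite -(pmulr_rge0 _ Lc); nra.
Qed.

(** The scalar product of grad J x and v is half of
    |grad J x|^2 + |v|^2 - |v - grad J x|^2; with step 1 / (2 L) the quadratic
    term of the model takes back half of the |v|^2. *)
Lemma ascent_step (x v e : 'rV[R]_d) : e = v - grad J x ->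
  enorm (grad J x) ^+ 2 + 2^-1 * enorm v ^+ 2 <=
  4 * L * (J (x + (2 * L)^-1 *: v) - J x) + enorm e ^+ 2.
Proof.
move=> ->; have := smooth_lower_bound x ((2 * L)^-1 *: v).
rewrite enormZ_sqr.
have -> : dot (grad J x) ((2 * L)^-1 *: v) =
    (4 * L)^-1 * (enorm (grad J x) ^+ 2 + enorm v ^+ 2 - enorm (v - grad J x) ^+ 2).
  rewrite !enorm_sqr -big_split -sumrB mulr_sumr; apply: eq_bigr => i _ /=.
  by rewrite !mxE; field; rewrite gt_eqF.
rewrite -(ler_pM2l (_ : 0 < 4 * L)) ?mulr_gt0//.
set n1 := enorm _ ^+ 2; set n2 := enorm v ^+ 2; set n3 := enorm _ ^+ 2.
have -> : 4 * L * (J x + (4 * L)^-1 * (n1 + n2 - n3) - L / 2 * ((2 * L)^-1 ^+ 2 * n2)) =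
   4 * L * J x + (n1 + n2 - n3) - n2 / 2.
  by field; rewrite gt_eqF.
by rewrite mulrBr; lra.
Qed.

End ascent.

(** * Functions of the history *)

Lemma measurable_funV_ge0 dT (T : measurableType dT) (R : realType) (f : T -> R) :
  (forall x, 0 <= f x) -> measurable_fun setT f ->
  measurable_fun setT (fun x => (f x)^-1).
Proof.
move=> f0 mf.
have -> : (fun x => (f x)^-1) = (@powR R ^~ (-1)) \o f.
  by apply/funext => x /=; rewrite powR_inv1.
exact: (measurableT_comp (@measurable_powR R (-1)) mf).
Qed.

Lemma measurable_fun_roundup dT (T : measurableType dT) (R : realType)
    (f : T -> R) (h : nat -> R) :
  measurable_fun setT f -> measurable_fun setT (fun x => h (roundup (f x))).
Proof.
move=> mf _ Y mY; rewrite setTI.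
pose r (z : int) : nat := maxn 1 `|- z|%N.
rewrite (_ : _ @^-1` Y = \bigcup_(z in [set: int])
   ([set x | Num.floor (- f x) = z] `&` [set x | Y (h (r z))])).
  apply: countable_bigcupT_measurable; first exact: countableP.
  move=> z; apply: measurableI.
    by apply: measurable_fun_floor; exact: measurableT_comp.
  have [Yh|nYh] := pselect (Y (h (r z))).
    by rewrite (_ : [set _ | _] = setT)//; apply/seteqP; split.
  by rewrite (_ : [set _ | _] = set0)//; apply/seteqP; split.
have rE x : roundup (f x) = r (Num.floor (- f x)).
  by rewrite /roundup /r ceilNfloor.
apply/seteqP; split=> [x /= Yx|x [z _ [/= <-]]]; last by rewrite -rE.
by exists (Num.floor (- f x)) => //; split => //=; rewrite -rE.
Qed.

Section histories.
Context (R : realType) dO (Omega : measurableType dO) dT (T : measurableType dT).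
Context (d : nat) (tau : nat -> nat -> Omega -> T).

Definition draw_events (k : nat) : set (set Omega) :=
  [set F | exists j i E, [/\ (j < k)%N, measurable E & F = tau j i @^-1` E]].

Local Notation Om k := (g_sigma_algebraType (draw_events k)).

Lemma measurable_fun_history_le k k' dU (U : measurableType dU) (f : Omega -> U) :
  (k <= k')%N -> measurable_fun setT (f : Om k -> U) ->
  measurable_fun setT (f : Om k' -> U).
Proof.
move=> kk' mf _ Y mY; have := mf measurableT Y mY.
apply: sub_sigma_algebra2 => _ [j [i [E [jk mE ->]]]].
by exists j, i, E; split => //; exact: leq_trans jk kk'.
Qed.

Lemma measurable_draw k j i : (j < k)%N ->
  measurable_fun setT (tau j i : Om k -> T).
Proof.
move=> jk _ E mE; rewrite setTI; apply: sub_sigma_algebra.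
by exists j, i, E.
Qed.

(** Measurability with respect to the history before iteration k, by
    coordinates. *)
Definition hist_vec k (u : Omega -> 'rV[R]_d) :=
  forall i, measurable_fun setT ((fun w => u w 0 i) : Om k -> R).

Lemma hist_vec_le k k' u : (k <= k')%N -> hist_vec k u -> hist_vec k' u.
Proof. by move=> kk' mu i; exact: measurable_fun_history_le kk' (mu i). Qed.

Lemma hist_vecD k u v : hist_vec k u -> hist_vec k v ->
  hist_vec k (fun w => u w + v w).
Proof.
move=> mu mv i; under eq_fun do rewrite mxE.
exact: (measurable_funD (mu i) (mv i)).
Qed.

Lemma hist_vecZ k (a : Omega -> R) u :
  measurable_fun setT (a : Om k -> R) -> hist_vec k u ->
  hist_vec k (fun w => a w *: u w).
Proof.
move=> ma mu i; under eq_fun do rewrite mxE.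
exact: (measurable_funM ma (mu i)).
Qed.

Lemma hist_vecB k u v : hist_vec k u -> hist_vec k v ->
  hist_vec k (fun w => u w - v w).
Proof.
move=> mu mv i; under eq_fun do rewrite !mxE.
exact: (measurable_funB (mu i) (mv i)).
Qed.

Lemma hist_vec_sum k (s : seq nat) (u : nat -> Omega -> 'rV[R]_d) :
  (forall n, hist_vec k (u n)) -> hist_vec k (fun w => \sum_(n <- s) u n w).
Proof.
move=> mu i; under eq_fun do rewrite summxE.
by apply: (@measurable_sum _ (Om k)) => n; exact: mu.
Qed.

Lemma measurable_enorm_sqr k u : hist_vec k u ->
  measurable_fun setT ((fun w => enorm (u w) ^+ 2) : Om k -> R).
Proof.
move=> mu; under eq_fun do rewrite enorm_sqr.
apply: (@measurable_sum _ (Om k)) => i; apply: measurable_funX; exact: mu.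
Qed.

Lemma measurable_fun_param k (f : 'rV[R]_d -> T -> R) (u : Omega -> 'rV[R]_d) :
  (forall x, measurable_fun setT (f x)) -> (forall t, continuous (f ^~ t)) ->
  hist_vec k u ->
  measurable_fun setT (fun z : Om k * T => f (u z.1) z.2).
Proof. by move=> mf cf mu; exact: (@measurable_fun_caratheodory _ (Om k) _ T R d f
    u). Qed.

Lemma measurable_fun_param_draw k j i (f : 'rV[R]_d -> T -> R) (u : Omega -> 'rV[R]_d) :
  (forall x, measurable_fun setT (f x)) -> (forall t, continuous (f ^~ t)) ->
  (j < k)%N -> hist_vec k u ->
  measurable_fun setT ((fun w => f (u w) (tau j i w)) : Om k -> R).
Proof.
move=> mf cf jk mu; have mz := measurable_fun_param mf cf mu.
have h : measurable_fun setT (fun w : Om k => (w, tau j i w)).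
  by apply/measurable_fun_pairP; split; [exact: measurable_id|exact: measurable_draw].
exact: (measurableT_comp mz h).
Qed.

End histories.

(** * The noise of one trajectory *)

Lemma coordB (R : realType) d (x y : 'rV[R]_d) i :
  (x - y) 0 i = x 0 i - y 0 i.
Proof. by rewrite !mxE. Qed.

Lemma scale_coord (R : realType) d (a : R) (x : 'rV[R]_d) i :
  (a *: x) 0 i = a * x 0 i.
Proof. by rewrite mxE. Qed.

Section problem.
Context (R : realType) (dS dA : measure_display).
Context (S : measurableType dS) (A : measurableType dA) (M : mdp R S A).
Context (H d : nat) (pi : 'rV[R]_d -> S -> A -> R).
Local Notation traj := (H.-tuple (S * A)%type).
Context (g : traj -> 'rV[R]_d -> 'rV[R]_d).
Context (G CH Rmax sigma L Lg Gamma alphaw : R).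
Local Notation J := (perf M H pi).
Local Notation p := (traj_pdf M pi).
Local Notation muT := (traj_measure M H).
Local Notation Q := (2 * (Lg ^+ 2 + Gamma * alphaw)).

Hypothesis ppi : is_policy M pi.
Hypothesis mg : forall x i, measurable_fun setT (fun t => g t x 0 i).
Hypothesis unb : unbiased M pi g.
Hypothesis scores : bounded_scores M pi G CH Rmax.
Hypothesis var : bounded_variance M pi g sigma.
Hypothesis consts : problem_constants M pi g L Lg Gamma alphaw.

Lemma problem_L_gt0 : 0 < L. Proof. by case: consts. Qed.

Lemma Gamma_ge0 (t : traj) : 0 <= Gamma.
Proof.
by have [_ _ _ /(_ t 0 0)[_ /(le_trans _)] h _] := consts; apply: h; exact: sqr_ge0.
Qed.

Lemma problem_Q_ge0 (t : traj) : 0 <= Q.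
Proof.
have [_ aw _ _ _] := consts.
rewrite mulr_ge0// addr_ge0 ?sqr_ge0// mulr_ge0 ?(ltW aw)//.
exact: Gamma_ge0 t.
Qed.

Let mp x : measurable_fun setT (p x : traj -> R).
Proof. exact: measurable_traj_pdf. Qed.

Let p0 x (t : traj) : 0 <= p x t.
Proof. exact: traj_pdf_ge0. Qed.

Let p1 x : (\int[muT]_t (p x t)%:E = 1)%E.
Proof. exact: integral_traj_pdf. Qed.

Lemma g_coord_le (t : traj) x i : `|g t x 0 i| <= Num.sqrt Gamma.
Proof.
have [_ _ _ /(_ t x x)[_ h] _] := consts.
rewrite -sqrtr_sqr ler_wsqrtr//; apply: le_trans h.
exact: coord_sqr_le_enorm.
Qed.

Lemma continuous_g_coord (t : traj) i : continuous (fun x => g t x 0 i).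
Proof.
apply: (@continuous_lipschitz_l1 _ _ _ `|Lg|) => x y.
have [_ _ _ /(_ t x y)[h _] _] := consts.
apply: (@le_trans _ _ (enorm (g t x - g t y))).
  rewrite -sqrtr_sqr ler_wsqrtr//.
  have := coord_sqr_le_enorm (g t x - g t y) i.
  by rewrite enorm_sqr coordB.
apply: le_trans h _; apply: (@le_trans _ _ (`|Lg| * enorm (x - y))).
  by rewrite ler_wpM2r ?sqrtr_ge0 ?ler_norm.
rewrite ler_wpM2l//; apply: le_trans (enorm_le_l1 _) _.
by under eq_bigr do rewrite coordB.
Qed.

Lemma continuous_grad_coord i : continuous (fun x => grad J x 0 i).
Proof.
apply: (@continuous_lipschitz_l1 _ _ _ L) => x y.
have [L0 _ /(_ x y) h _ _] := consts.
apply: (@le_trans _ _ (enorm (grad J x - grad J y))).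
  rewrite -sqrtr_sqr ler_wsqrtr//.
  have := coord_sqr_le_enorm (grad J x - grad J y) i.
  by rewrite enorm_sqr coordB.
apply: le_trans h _; rewrite ler_wpM2l ?(ltW L0)//.
apply: le_trans (enorm_le_l1 _) _.
by under eq_bigr do rewrite coordB.
Qed.

Lemma integrable_pdf_bounded x (f : traj -> R) (C : R) :
  measurable_fun setT f -> (forall t, `|f t| <= C) ->
  muT.-integrable setT (fun t => (p x t * f t)%:E).
Proof.
move=> mf fC; apply/integrableP; split.
  by apply/measurable_EFinP; exact: measurable_funM.
apply: (@le_lt_trans _ _ (\int[muT]_t ((C)%:E * (p x t)%:E))%E).
  apply: ge0_le_integral => //.
  - apply: measurableT_comp => //; apply/measurable_EFinP; exact: measurable_funM.
  - by apply: emeasurable_funM => //; exact/measurable_EFinP.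
  - move=> t _; rewrite -EFinM lee_fin normrM (ger0_norm (p0 _ _)) mulrC.
    by rewrite ler_wpM2r.
rewrite integralZl//; last first.
  apply/integrableP; split; first exact/measurable_EFinP.
  under eq_integral => t _ do rewrite gee0_abs ?lee_fin//.
  by rewrite p1 ltry.
by rewrite p1 mule1 ltry.
Qed.

Lemma integral_pdf_cst x (c : R) : (\int[muT]_t (p x t * c)%:E = c%:E)%E.
Proof.
under eq_integral do rewrite EFinM muleC.
rewrite integralZl//; first by rewrite p1 mule1.
apply/integrableP; split; first exact/measurable_EFinP.
under eq_integral => t _ do rewrite gee0_abs ?lee_fin//.
by rewrite p1 ltry.
Qed.

Lemma integral_pdf_g x i :
  (\int[muT]_t (p x t * g t x 0 i)%:E = (grad J x 0 i)%:E)%E.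
Proof. by have [_ /(_ i)] := unb x. Qed.

Lemma integrable_pdf_g x i :
  muT.-integrable setT (fun t => (p x t * g t x 0 i)%:E).
Proof. exact: integrable_pdf_bounded (g_coord_le ^~ x ^~ i). Qed.

(** grad J is the mean of g. *)
Lemma grad_coord_le x i : `|grad J x 0 i| <= Num.sqrt Gamma.
Proof.
rewrite -lee_fin -abse_EFin -integral_pdf_g.
apply: le_trans (le_abse_integral _ _ _) _ => //.
  by case/integrableP: (integrable_pdf_g x i).
rewrite -(integral_pdf_cst x); apply: ge0_le_integral => //.
- apply: measurableT_comp => //; apply/measurable_EFinP; exact: measurable_funM.
- by apply/measurable_EFinP; exact: measurable_funM.
- by move=> t _; rewrite lee_fin normrM (ger0_norm (p0 _ _)) ler_wpM2l// g_coord_le.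
Qed.

Lemma grad_enorm_le x : enorm (grad J x) ^+ 2 <= d%:R * Num.sqrt Gamma ^+ 2.
Proof.
rewrite enorm_sqr mulr_natl -[in X in _ <= X](card_ord d) -sumr_const.
apply: ler_sum => i _; rewrite -real_normK ?num_real//.
by rewrite ler_pXn2r ?nnegrE ?sqrtr_ge0// grad_coord_le.
Qed.

Definition big_noise x (t : traj) := g t x - grad J x.

Lemma measurable_big_noise x i : measurable_fun setT (fun t => big_noise x t 0 i).
Proof.
under eq_fun do rewrite /big_noise coordB.
by apply: measurable_funB => //; exact: measurable_cst.
Qed.

Lemma integrable_big_noise x i :
  muT.-integrable setT (fun t => (p x t * big_noise x t 0 i)%:E).
Proof.
apply: (@integrable_pdf_bounded x _ (Num.sqrt Gamma + Num.sqrt Gamma)).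
  exact: measurable_big_noise.
move=> t; rewrite /big_noise coordB; apply: le_trans (ler_normB _ _) _.
by rewrite lerD ?g_coord_le ?grad_coord_le.
Qed.

Lemma integral_big_noise x i :
  (\int[muT]_t (p x t * big_noise x t 0 i)%:E = 0)%E.
Proof.
transitivity (\int[muT]_t ((p x t * g t x 0 i)%:E - (p x t * grad J x 0 i)%:E))%E.
  by apply: eq_integral => t _; rewrite -EFinB /big_noise coordB mulrBr.
rewrite integralB//.
- by rewrite integral_pdf_g integral_pdf_cst subee.
- exact: integrable_pdf_g.
- apply: integrable_pdf_bounded; first exact: measurable_cst.
  by move=> _; exact: lexx.
Qed.

(** A random vector under p(. | x), of mean zero and total variance at most V. *)
Definition centered_noise x (X : traj -> 'rV[R]_d) (V : R) : Prop :=
  [/\ forall i, measurable_fun setT (fun t => X t 0 i),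
      forall i, muT.-integrable setT (fun t => (p x t * X t 0 i)%:E),
      forall i, (\int[muT]_t (p x t * X t 0 i)%:E = 0)%E &
      (\int[muT]_t (p x t * enorm (X t) ^+ 2)%:E <= V%:E)%E].

Lemma integral_pdf_enorm_sqr x (X : traj -> 'rV[R]_d) :
  (forall i, measurable_fun setT (fun t => X t 0 i)) ->
  (\int[muT]_t (p x t * enorm (X t) ^+ 2)%:E =
   \sum_(i < d) \int[muT]_t (p x t * X t 0 i ^+ 2)%:E)%E.
Proof.
move=> mX; rewrite -ge0_integral_sum//.
- by apply: eq_integral => t _; rewrite enorm_sqr mulr_sumr sumEFin.
- move=> i; apply/measurable_EFinP; apply: measurable_funM => //.
  exact: measurable_funX.
- by move=> i t _; rewrite lee_fin mulr_ge0// sqr_ge0.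
Qed.

(** Coordinate by coordinate this is [integral_tuple_sqr_sum]; the hypotheses
    bound only the sum of the variances of the coordinates. *)
Lemma centered_noise_batch x X V n (a : nat -> R) (b : 'rV[R]_d) :
  centered_noise x X V ->
  (\int[tuple_measure muT n]_t
     ((\prod_(i < n) p x (tnth t i)) *
      enorm (b + \sum_(i < n) a i *: X (tnth t i)) ^+ 2)%:E <=
   (enorm b ^+ 2 + (\sum_(i < n) a i ^+ 2) * V)%:E)%E.
Proof.
move=> [mX iX X0 XV].
pose v j := fine (\int[muT]_t (p x t * X t 0 j ^+ 2)%:E)%E.
have pXX0 j : (0 <= \int[muT]_t (p x t * X t 0 j ^+ 2)%:E)%E.
  by apply: integral_ge0 => t _; rewrite lee_fin mulr_ge0// sqr_ge0.
have sumV : (\sum_(j < d) \int[muT]_t (p x t * X t 0 j ^+ 2)%:E <= V%:E)%E.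
  by rewrite -integral_pdf_enorm_sqr.
have vE j : (\int[muT]_t (p x t * X t 0 j ^+ 2)%:E = (v j)%:E)%E.
  rewrite /v fineK// ge0_fin_numE//; apply: le_lt_trans (ltry V).
  by apply: le_trans sumV; rewrite (bigD1 j)//= leeDl// sume_ge0.
have svV : \sum_(j < d) v j <= V.
  by rewrite -lee_fin -sumEFin; under eq_bigr do rewrite -vE.
have mF j : measurable_fun setT (fun t : n.-tuple traj =>
    (\prod_(i < n) p x (tnth t i)) * (b 0 j + \sum_(i < n) a i * X (tnth t i) 0 j) ^+
        2).
  apply: measurable_funM; first exact: (@measurable_fun_prod_tnth _ _ _ _ (fun=> p x)).
  apply: measurable_funX; apply: measurable_funD => //.
  apply: measurable_sum => i; apply: measurable_funM => //.
  exact: (measurableT_comp (mX j) (measurable_tnth i)).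
have F0 j (t : n.-tuple traj) :
    0 <= (\prod_(i < n) p x (tnth t i)) * (b 0 j + \sum_(i < n) a i * X (tnth t i) 0
        j) ^+ 2.
  by rewrite mulr_ge0 ?sqr_ge0 ?prodr_ge0.
rewrite (_ : (\int[_]_t _)%E = (\sum_(j < d) (b 0 j ^+ 2 + (\sum_(i < n) a i ^+ 2) *
    v j)%:E)%E).
  rewrite sumEFin lee_fin big_split /= -enorm_sqr -mulr_sumr lerD2l.
  by rewrite ler_wpM2l// sumr_ge0// => i _; exact: sqr_ge0.
transitivity (\sum_(j < d) \int[tuple_measure muT n]_t
   ((\prod_(i < n) p x (tnth t i)) * (b 0 j + \sum_(i < n) a i * X (tnth t i) 0 j) ^+
       2)%:E)%E.
  rewrite -ge0_integral_sum//.
  - apply: eq_integral => t _; rewrite enorm_sqr mulr_sumr -sumEFin.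
    apply: eq_bigr => j _; rewrite mxE summxE.
    congr (_ * (_ + _) ^+ 2)%:E; apply: eq_bigr => i _; exact: scale_coord.
  - by move=> j; apply/measurable_EFinP; exact: mF.
  - by move=> j t _; rewrite lee_fin; exact: F0.
apply: eq_bigr => j _.
exact: (integral_tuple_sqr_sum (mp x) (p0 x) (p1 x) (mX j) (iX j) (X0 j) (vE j)).
Qed.

(** The noise of the recursive estimate of grad J x - grad J y; importance
    weighting lets the same trajectory, drawn at x, serve for y. *)
Definition small_noise x y (t : traj) : 'rV[R]_d :=
  g t x - weight M pi t x y *: g t y - (grad J x - grad J y).

Lemma measurable_weight x y : measurable_fun setT (fun t : traj => weight M pi t x y).
Proof.
by apply: measurable_funM => //; apply: measurable_funV_ge0.
Qed.

Lemma pdf_small_noise x y t i :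
  p x t * small_noise x y t 0 i =
  p x t * g t x 0 i - p y t * g t y 0 i - p x t * (grad J x - grad J y) 0 i.
Proof.
have -> : small_noise x y t 0 i = g t x 0 i - weight M pi t x y * g t y 0 i -
    (grad J x - grad J y) 0 i.
  by rewrite /small_noise !coordB scale_coord.
by rewrite !mulrBr mulrA (traj_pdf_weight scores).
Qed.

(** Centering does not increase a second moment, so it is enough to bound that of
    Y = (g x - g y) + (1 - weight) g y, whose terms are controlled by Lg and by
    Gamma alphaw. *)
Lemma centered_small_noise x y :
  centered_noise x (small_noise x y) (Q * enorm (x - y) ^+ 2).
Proof.
pose Y (t : traj) := g t x - weight M pi t x y *: g t y.
have mY i : measurable_fun setT (fun t => Y t 0 i).
  rewrite /Y; under eq_fun do rewrite coordB scale_coord.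
  apply: measurable_funB => //; apply: measurable_funM => //.
  exact: measurable_weight.
have mX i : measurable_fun setT (fun t => small_noise x y t 0 i).
  rewrite /small_noise; under eq_fun do rewrite coordB.
  by apply: measurable_funB; [exact: mY|exact: measurable_cst].
have ic i : muT.-integrable setT (fun t => (p x t * (grad J x - grad J y) 0 i)%:E).
  apply: integrable_pdf_bounded; first exact: measurable_cst.
  by move=> _; exact: lexx.
have igg i : muT.-integrable setT (fun t =>
    ((p x t * g t x 0 i)%:E - (p y t * g t y 0 i)%:E)%E).
  by apply: integrableB => //; exact: integrable_pdf_g.
have iX i : muT.-integrable setT (fun t => (p x t * small_noise x y t 0 i)%:E).
  under eq_fun do rewrite pdf_small_noise !EFinB.
  exact: integrableB.
have X0 i : (\int[muT]_t (p x t * small_noise x y t 0 i)%:E = 0)%E.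
  under eq_integral do rewrite pdf_small_noise !EFinB.
  rewrite integralB// integralB//; last 2 first.
  - exact: integrable_pdf_g.
  - exact: integrable_pdf_g.
  by rewrite !integral_pdf_g integral_pdf_cst -!EFinB coordB subrr.
have YQ : (\int[muT]_t (p x t * enorm (Y t) ^+ 2)%:E <=
           (Q * enorm (x - y) ^+ 2)%:E)%E.
  have [_ _ _ lg /(_ x y) wa] := consts.
  have mw : measurable_fun setT (fun t : traj => `|1 - weight M pi t x y| ^+ 2).
    apply: measurable_funX; apply: measurableT_comp => //.
    by apply: measurable_funB => //; exact: measurable_weight.
  have C0 : 0 <= 2 * (Lg * enorm (x - y)) ^+ 2 by rewrite mulr_ge0// sqr_ge0.
  have G0 : 0 <= 2 * Gamma.
    by rewrite mulr_ge0//; exact: (Gamma_ge0 point).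
  apply: (@le_trans _ _ (\int[muT]_t ((2 * (Lg * enorm (x - y)) ^+ 2)%:E * (p x t)%:E +
    (2 * Gamma)%:E * (p x t * `|1 - weight M pi t x y| ^+ 2)%:E))%E).
    apply: ge0_le_integral => //.
    - by move=> t _; rewrite lee_fin mulr_ge0// sqr_ge0.
    - apply/measurable_EFinP; apply: measurable_funM => //.
      under eq_fun do rewrite enorm_sqr.
      by apply: measurable_sum => i; exact: measurable_funX.
    - apply: emeasurable_funD; apply: emeasurable_funM => //; apply/measurable_EFinP
        => //.
      exact: measurable_funM.
    move=> t _; rewrite -!EFinM -EFinD lee_fin.
    rewrite [leRHS](_ : _ = p x t * (2 * (Lg * enorm (x - y)) ^+ 2 +
      2 * (`|1 - weight M pi t x y| ^+ 2 * Gamma))); last by ring.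
    rewrite ler_wpM2l//.
    have -> : Y t = (g t x - g t y) + (1 - weight M pi t x y) *: g t y.
      by rewrite /Y scalerBl scale1r addrA subrK.
    apply: le_trans (enormD_sqr_le _ _) _.
    rewrite lerD// ler_wpM2l//.
      have [h _] := lg t x y.
      by rewrite ler_pXn2r ?nnegrE ?sqrtr_ge0//; apply: le_trans h; exact: sqrtr_ge0.
    rewrite enormZ_sqr real_normK ?num_real// ler_wpM2l ?sqr_ge0//.
    by have [_] := lg t y y.
  rewrite ge0_integralD//; last 4 first.
  - by move=> t _; rewrite -EFinM lee_fin mulr_ge0.
  - by apply: emeasurable_funM => //; apply/measurable_EFinP.
  - by move=> t _; rewrite -EFinM lee_fin mulr_ge0// mulr_ge0// sqr_ge0.
  - apply: emeasurable_funM => //; apply/measurable_EFinP.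
    exact: measurable_funM.
  rewrite ge0_integralZl//; last 2 first.
  - exact/measurable_EFinP.
  - by move=> t _; rewrite lee_fin.
  rewrite p1 mule1 ge0_integralZl//; last 2 first.
  - by apply/measurable_EFinP; exact: measurable_funM.
  - by move=> t _; rewrite lee_fin mulr_ge0// sqr_ge0.
  rewrite [leRHS](_ : _ = (2 * (Lg * enorm (x - y)) ^+ 2)%:E +
    (2 * Gamma)%:E * (alphaw * enorm (x - y) ^+ 2)%:E)%E; last first.
    by rewrite -EFinM -EFinD; congr (_%:E); ring.
  by rewrite leeD// lee_wpmul2l// lee_fin.
split=> //.
apply: le_trans YQ; rewrite !integral_pdf_enorm_sqr//.
apply: lee_sum => i _.
have pYY0 j : (0 <= \int[muT]_t (p x t * Y t 0 j ^+ 2)%:E)%E.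
  by apply: integral_ge0 => t _; rewrite lee_fin mulr_ge0// sqr_ge0.
have [YYoo|YYfin] := eqVneq (\int[muT]_t (p x t * Y t 0 i ^+ 2)%:E)%E +oo%E.
  by rewrite YYoo leey.
have iYY : muT.-integrable setT (fun t => (p x t * Y t 0 i ^+ 2)%:E).
  apply/integrableP; split.
    by apply/measurable_EFinP; apply: measurable_funM => //; exact: measurable_funX.
  under eq_integral => t _.
    rewrite gee0_abs ?lee_fin; last by rewrite mulr_ge0// sqr_ge0.
    over.
  by rewrite ltey.
set c := (grad J x - grad J y) 0 i.
have XY t : small_noise x y t 0 i = Y t 0 i - c by rewrite /small_noise coordB.
have i2 : muT.-integrable setT (fun t => (2 * c)%:E * (p x t * small_noise x y t 0
    i)%:E)%E.
  exact: integrableZl.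
have i3 : muT.-integrable setT (fun t => (p x t * c ^+ 2)%:E).
  apply: integrable_pdf_bounded; first exact: measurable_cst.
  by move=> _; exact: lexx.
have -> : (\int[muT]_t (p x t * small_noise x y t 0 i ^+ 2)%:E =
    \int[muT]_t ((p x t * Y t 0 i ^+ 2)%:E -
      (2 * c)%:E * (p x t * small_noise x y t 0 i)%:E - (p x t * c ^+ 2)%:E))%E.
  by apply: eq_integral => t _; rewrite -EFinM -!EFinB XY; congr (_%:E); ring.
rewrite integralB//; last exact: integrableB.
rewrite integralB// integralZl// X0 mule0 sube0 integral_pdf_cst.
by rewrite leeBlDr// leeDl// lee_fin sqr_ge0.
Qed.

Lemma centered_big_noise x : centered_noise x (big_noise x) (sigma ^+ 2).
Proof.
split; [exact: measurable_big_noise|exact: integrable_big_noise|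
  exact: integral_big_noise|exact: var].
Qed.

End problem.

(** * Rounded batch sizes *)

(** The size N of a large batch is random. Averaging over it is a weighted sum
    over a deterministic number of draws, which is the form that
    [ge0_integral_freezing] needs. *)
Lemma big_batch_weight_sum (R : realType) (V : lmodType R) (N Nmax : nat) (F : nat ->
    V) :
  (N <= Nmax)%N ->
  N%:R^-1 *: \sum_(i < N) F i =
  \sum_(i < Nmax) ((i < N)%N%:R / N%:R) *: F i.
Proof.
move=> NN; rewrite (big_ord_widen _ F NN) big_mkcond scaler_sumr.
apply: eq_bigr => i _; case: ifP => _; first by rewrite mul1r.
by rewrite mul0r scale0r scaler0.
Qed.

Lemma big_batch_weight_sqr (R : realType) (N Nmax : nat) :
  (0 < N <= Nmax)%N ->
  \sum_(i < Nmax) ((i < N)%N%:R / N%:R : R) ^+ 2 = N%:R^-1.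
Proof.
move=> /andP[N0 NN].
transitivity (\sum_(i < N) (N%:R^-1 : R) ^+ 2).
  rewrite [RHS](big_ord_widen _ (fun=> (N%:R^-1 : R) ^+ 2) NN) [RHS]big_mkcond.
  by apply: eq_bigr => i _; case: ifP => _; rewrite ?mul1r// mul0r expr0n.
rewrite sumr_const card_ord -[LHS]mulr_natl expr2 mulrA divff ?mul1r//.
by rewrite pnatr_eq0 -lt0n.
Qed.

Lemma big_batch_weight1 (R : realType) (N Nmax : nat) :
  (0 < N <= Nmax)%N -> \sum_(i < Nmax) ((i < N)%N%:R / N%:R : R) = 1.
Proof.
move=> /andP[N0 NN].
transitivity (\sum_(i < N) (N%:R^-1 : R)).
  rewrite [RHS](big_ord_widen _ (fun=> (N%:R^-1 : R)) NN) [RHS]big_mkcond.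
  by apply: eq_bigr => i _; case: ifP => _; rewrite ?mul1r// mul0r.
by rewrite sumr_const card_ord -[LHS]mulr_natl divff// pnatr_eq0 -lt0n.
Qed.

Lemma roundup_gt0 (R : realType) (x : R) : (0 < roundup x)%N.
Proof. by rewrite /roundup leq_max. Qed.

Lemma roundup_ge (R : realType) (x : R) : x <= (roundup x)%:R.
Proof.
apply: le_trans (ceil_ge x) _; apply: (@le_trans _ _ (`|Num.ceil x|%N%:R)).
  by rewrite natr_absz ler_int ler_norm.
by rewrite ler_nat leq_max leqnn orbT.
Qed.

(** The rounding exceeds x by at most 1, also when it replaces 0 by 1. *)
Lemma roundup_pred_le (R : realType) (x : R) : 0 <= x ->
  (roundup x)%:R - 1 <= x.
Proof.
move=> x0; have c0 : 0 <= Num.ceil x by rewrite ceil_ge0// (lt_le_trans _ x0).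
rewrite /roundup /maxn; case: ltnP => _; last by rewrite subrr.
rewrite natr_absz ger0_norm//; have /andP[/ltW] := ceil_itv x.
by rewrite intrB.
Qed.

Lemma le_roundup (R : realType) (x y : R) : 0 <= x -> x <= y ->
  (roundup x <= roundup y)%N.
Proof.
move=> x0 xy; rewrite /roundup geq_max leq_max leqnn /= leq_max; apply/orP; right.
have y0 := le_trans x0 xy.
rewrite -lez_nat !gez0_abs ?ceil_ge0 ?(lt_le_trans _ x0) ?(lt_le_trans _ y0)//.
exact: le_ceil.
Qed.

Lemma fine_le_affine (R : realType) (x y z : \bar R) (a b c r : R) :
  x = a%:E -> y = b%:E -> z = c%:E -> (x <= y + r%:E * z)%E -> a <= b + r * c.
Proof. by move=> -> -> ->; rewrite -EFinM -EFinD lee_fin. Qed.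

(** * The errors along a run *)

Section abaspider.
Context (R : realType) (dS dA : measure_display).
Context (S : measurableType dS) (A : measurableType dA) (M : mdp R S A).
Context (H d : nat) (pi : 'rV[R]_d -> S -> A -> R).
Local Notation traj := (H.-tuple (S * A)%type).
Context (g : traj -> 'rV[R]_d -> 'rV[R]_d).
Context (G CH Rmax sigma L Lg Gamma alphaw : R).
Local Notation J := (perf M H pi).
Local Notation p := (traj_pdf M pi).
Local Notation muT := (traj_measure M H).
Local Notation Q := (2 * (Lg ^+ 2 + Gamma * alphaw)).

Hypothesis ppi : is_policy M pi.
Hypothesis mg : forall x i, measurable_fun setT (fun t => g t x 0 i).
Hypothesis unb : unbiased M pi g.
Hypothesis scores : bounded_scores M pi G CH Rmax.
Hypothesis var : bounded_variance M pi g sigma.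
Hypothesis consts : problem_constants M pi g L Lg Gamma alphaw.

Context (eta eps alpha beta : R) (theta0 : 'rV[R]_d) (m B K : nat).
Context (dO : measure_display) (Omega : measurableType dO) (P : probability Omega R).
Context (tau : nat -> nat -> Omega -> traj) (theta v : nat -> Omega -> 'rV[R]_d).
Hypotheses (eps0 : 0 < eps) (alpha0 : 0 < alpha) (beta0 : 0 <= beta) (B0 : (0 < B)%N).
Hypothesis run :
  abaspider_pg M pi P g theta0 sigma eta eps alpha beta m B K tau theta v.

Local Notation Om k := (g_sigma_algebraType (draw_events tau k)).

Lemma draw_events_measurable k : (k <= K.+1)%N ->
  draw_events tau k `<=` measurable.
Proof.
move=> kK _ [j [i [E [jk mE ->]]]].
have jK : (j <= K)%N by rewrite -ltnS; exact: leq_trans jk kK.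
have [mtau _] := abaspider_draws run jK.
by rewrite -[X in measurable X]setTI; exact: mtau.
Qed.

Lemma measurable_of_history k dU (U : measurableType dU) (f : Omega -> U) :
  (k <= K.+1)%N -> measurable_fun setT (f : Om k -> U) ->
  measurable_fun setT (f : Omega -> U).
Proof.
by move=> kK; exact: (sub_sigma_measurable_fun (draw_events_measurable kK)).
Qed.

Local Notation N k w := (big_batch sigma eps alpha beta m (v ^~ w) k).
Local Notation Nmax := (roundup (alpha * sigma ^+ 2 / eps)).
Local Notation bsum k w :=
  (\sum_((k %/ m * m)%N - m <= i < (k %/ m * m)%N) enorm (v i w) ^+ 2).

Let bsum_ge0 k w : 0 <= beta / m%:R * bsum k w.
Proof. by rewrite mulr_ge0 ?divr_ge0// sumr_ge0// => i _; exact: sqr_ge0. Qed.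

Let den_gt0 k w : 0 < beta / m%:R * bsum k w + eps.
Proof. by rewrite ltr_wpDl. Qed.

Lemma big_batch_gt0 k w : (0 < N k w)%N.
Proof. exact: roundup_gt0. Qed.

Lemma big_batch_le k w : (N k w <= Nmax)%N.
Proof.
have s0 : 0 <= alpha * sigma ^+ 2 by rewrite mulr_ge0 ?sqr_ge0 ?ltW.
apply: le_roundup; first by rewrite divr_ge0// ltW// den_gt0.
by rewrite ler_wpM2l// lef_pV2 ?posrE// ?lerDr.
Qed.

Lemma big_batch_variance k w :
  sigma ^+ 2 / (N k w)%:R <= (beta / m%:R * bsum k w + eps) / alpha.
Proof.
rewrite ler_pdivrMr ?ltr0n ?big_batch_gt0// mulrAC ler_pdivlMr//.
rewrite [leLHS]mulrC -ler_pdivrMl//.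
apply: le_trans _ (roundup_ge (alpha * sigma ^+ 2 / (beta / m%:R * bsum k w + eps))).
by rewrite [leLHS]mulrC.
Qed.

Let a k i w : R := (i < N k w)%N%:R / (N k w)%:R.

Lemma measurable_bsum k : (forall j, (j < k)%N -> hist_vec tau k (v j)) ->
  measurable_fun setT ((fun w => bsum k w) : Om k -> R).
Proof.
move=> mv.
have -> : (fun w => bsum k w) = (fun w =>
    \sum_((k %/ m * m)%N - m <= j < (k %/ m * m)%N)
      if (j < k)%N then enorm (v j w) ^+ 2 else 0).
  apply/funext => w; rewrite [LHS]big_nat [RHS]big_nat.
  by apply: eq_bigr => j /andP[_ jk]; rewrite (leq_trans jk) ?leq_divM.
apply: (@measurable_sum _ (Om k)) => j.
have [jk|_] := boolP (j < k)%N; last exact: measurable_cst.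
exact: measurable_enorm_sqr (mv j jk).
Qed.

Lemma measurable_batch_weight k i :
  (forall j, (j < k)%N -> hist_vec tau k (v j)) ->
  measurable_fun setT (a k i : Om k -> R).
Proof.
move=> mv; apply: (@measurable_fun_roundup _ (Om k) R _ (fun n => (i < n)%N%:R / n%:R)).
apply: measurable_funM; first exact: measurable_cst.
apply: measurable_funV_ge0; first by move=> w; exact: ltW (den_gt0 k w).
apply: measurable_funD; last exact: measurable_cst.
by apply: measurable_funM; [exact: measurable_cst|exact: measurable_bsum].
Qed.

(** The batch of iteration k is part of the history only from k.+1 on, hence the
    shift between theta and v. *)
Lemma run_measurable k : (k <= K)%N ->
  hist_vec tau k (theta k) /\ hist_vec tau k.+1 (v k).
Proof.
elim/ltn_ind: k => k IH kK.
have mth : hist_vec tau k (theta k).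
  case: k IH kK => [|k] IH kK.
    move=> i; under eq_fun do rewrite (abaspider_init run).
    exact: measurable_cst.
  have [||mthk mvk] := IH k => //; first exact: ltnW.
  have -> : theta k.+1 = fun w => theta k w + eta *: v k w.
    by apply/funext => w; rewrite (abaspider_step run)// ltnW.
  apply: hist_vecD; first exact: hist_vec_le mthk.
  by apply: hist_vecZ => //; exact: measurable_cst.
split=> //.
have mgk j y : hist_vec tau k y -> hist_vec tau k.+1 (fun w => g (tau k j w) (y w)).
  move=> my i.
  apply: (@measurable_fun_param_draw _ _ _ _ _ _ tau k.+1 k j (fun x t => g t x 0 i)
      y) => //.
  - by move=> t; exact: continuous_g_coord consts t i.
  - exact: hist_vec_le my.
have [mk|nmk] := boolP (m %| k)%N.
  have ma i : measurable_fun setT (a k i : Om k.+1 -> R).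
    apply: (measurable_fun_history_le (leqnSn k)).
    apply: measurable_batch_weight => j jk.
    have [_ mvj] := IH j jk (leq_trans (ltnW jk) kK).
    exact: hist_vec_le jk mvj.
  have -> : v k = fun w => \sum_(i < Nmax) a k i w *: g (tau k i w) (theta k w).
    apply/funext => w; rewrite (abaspider_big run)//.
    by rewrite (big_batch_weight_sum (fun i => g (tau k i w) (theta k w))
        (big_batch_le k w)).
  under [X in hist_vec _ _ X]funext => w do
    rewrite -(big_mkord xpredT (fun i => a k i w *: g (tau k i w) (theta k w))).
  by apply: hist_vec_sum => i; apply: hist_vecZ => //; exact: mgk.
have k0 : (0 < k)%N by case: k nmk {IH kK mth mgk} => //; rewrite dvdn0.
have [||mthk mvk] := IH k.-1; [by rewrite prednK|exact: leq_trans (leq_pred k) kK|].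
rewrite prednK// in mvk.
have mthk1 := hist_vec_le (leq_pred k) mthk.
have mw j : measurable_fun setT ((fun w => weight M pi (tau k j w) (theta k w) (theta
    k.-1 w)) : Om k.+1 -> R).
  apply: measurable_funM.
    apply: (@measurable_fun_param_draw _ _ _ _ _ _ tau k.+1 k j (fun x t => traj_pdf
        M pi x t) (theta k.-1)) => //.
    - by move=> x; exact: measurable_traj_pdf.
    - by move=> t; exact: continuous_traj_pdf scores t.
    - exact: hist_vec_le mthk1.
  apply: measurable_funV_ge0; first by move=> w; exact: traj_pdf_ge0.
  apply: (@measurable_fun_param_draw _ _ _ _ _ _ tau k.+1 k j (fun x t => traj_pdf M
      pi x t) (theta k)) => //.
  - by move=> x; exact: measurable_traj_pdf.
  - by move=> t; exact: continuous_traj_pdf scores t.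
  - exact: hist_vec_le mth.
pose F j w := g (tau k j w) (theta k w) -
  weight M pi (tau k j w) (theta k w) (theta k.-1 w) *: g (tau k j w) (theta k.-1 w).
have -> : v k = fun w => B%:R^-1 *: (\sum_(0 <= j < B) F j w) + v k.-1 w.
  by apply/funext => w; rewrite (abaspider_small run)// big_mkord.
apply: hist_vecD; last exact: hist_vec_le mvk.
apply: hist_vecZ; first exact: measurable_cst.
apply: hist_vec_sum => j; apply: hist_vecB; first exact: mgk.
by apply: hist_vecZ => //; exact: mgk.
Qed.

Let mtheta k : (k <= K)%N -> hist_vec tau k (theta k).
Proof. by move=> /run_measurable[]. Qed.

(** Here b is what the past contributes and the c i are weights chosen by the
    past: freezing it turns the left-hand side into integrals over independent
    draws, to which [centered_noise_batch] applies. *)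
Lemma batch_second_moment k n (b : Omega -> 'rV[R]_d) (c : nat -> Omega -> R)
    (X : Omega -> traj -> 'rV[R]_d) (V : Omega -> R) :
  (k <= K)%N -> hist_vec tau k b ->
  (forall i, measurable_fun setT (c i : Om k -> R)) ->
  (forall j, measurable_fun setT (fun z : Om k * traj => X z.1 z.2 0 j)) ->
  measurable_fun setT (V : Om k -> R) ->
  (forall w, centered_noise M pi (theta k w) (X w) (V w)) ->
  (\int[P]_w (enorm (b w + \sum_(i < n) c i w *: X w (tau k i w)) ^+ 2)%:E <=
   \int[P]_w (enorm (b w) ^+ 2 + (\sum_(i < n) c i w ^+ 2) * V w)%:E)%E.
Proof.
move=> kK mb mc mX mV cX.
have kK1 : (k <= K.+1)%N := leqW kK.
pose h w (t : n.-tuple traj) := (enorm (b w + \sum_(i < n) c i w *: X w (tnth t i))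
    ^+ 2)%:E.
have h0 w t : (0 <= h w t)%E by rewrite lee_fin sqr_ge0.
have mp : measurable_fun setT (fun z : Om k * traj => p (theta k z.1) z.2).
  apply: (@measurable_fun_param _ _ _ _ _ _ tau k (fun x t => traj_pdf M pi x t)
      (theta k)).
  - by move=> x; exact: measurable_traj_pdf.
  - by move=> t; exact: continuous_traj_pdf scores t.
  - exact: mtheta.
have mtn i : measurable_fun setT (fun z : Om k * n.-tuple traj => (z.1, tnth z.2 i)).
  apply/measurable_fun_pairP; split; first exact: measurable_fst.
  exact: (measurableT_comp (measurable_tnth i) measurable_snd).
have mh : measurable_fun setT (fun z : Om k * n.-tuple traj => h z.1 z.2).
  apply/measurable_EFinP; rewrite /h.
  under eq_fun do rewrite enorm_sqr.
  apply: measurable_sum => j; apply: measurable_funX.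
  have -> : (fun z : Om k * n.-tuple traj =>
        (b z.1 + \sum_(i < n) c i z.1 *: X z.1 (tnth z.2 i)) 0 j) =
      (fun z => b z.1 0 j + \sum_(i < n) c i z.1 * X z.1 (tnth z.2 i) 0 j).
    apply/funext => z; rewrite mxE summxE; congr (_ + _).
    by apply: eq_bigr => i _; rewrite scale_coord.
  apply: measurable_funD; first exact: (measurableT_comp (mb j) measurable_fst).
  apply: measurable_sum => i; apply: measurable_funM.
    exact: (measurableT_comp (mc i) measurable_fst).
  exact: (measurableT_comp (mX j) (mtn i)).
have [mtau iid] := abaspider_draws run kK.
have -> : (\int[P]_w (enorm (b w + \sum_(i < n) c i w *: X w (tau k i w)) ^+ 2)%:E =
           \int[P]_w h w [tuple tau k i w | i < n])%E.
  apply: eq_integral => w _; rewrite /h; congr (enorm (_ + _) ^+ 2)%:E.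
  by apply: eq_bigr => i _; rewrite tnth_mktuple.
rewrite (@ge0_integral_freezing _ _ _ P (draw_events tau k)
  (draw_events_measurable kK1) _ _ muT n (tau k) (fun w t => p (theta k w) t))//.
- pose F w := (\int[tuple_measure muT n]_t ((\prod_(i < n) p (theta k w) (tnth t
    i))%:E * h w t))%E.
  have Fle w : (F w <= (enorm (b w) ^+ 2 + (\sum_(i < n) c i w ^+ 2) * V w)%:E)%E.
    have := @centered_noise_batch _ _ _ _ _ M H d pi ppi (theta k w) (X w) (V w) n (c
        ^~ w) (b w) (cX w).
    by under eq_integral do rewrite EFinM.
  have pr0 w t : (0 <= (\prod_(i < n) p (theta k w) (tnth t i))%:E * h w t)%E.
    by rewrite mule_ge0// lee_fin prodr_ge0// => i _; exact: traj_pdf_ge0.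
  apply: ge0_le_integral => //.
  + by move=> w _; apply: integral_ge0 => t _; exact: pr0.
  + apply: (measurable_of_history kK1 (f := F)).
    apply: (measurable_fun_fubini_tonelli_F (m2 := tuple_measure muT n)
      (fun z : Om k * n.-tuple traj => (\prod_(i < n) p (theta k z.1) (tnth z.2
          i))%:E * h z.1 z.2)%E).
      apply: emeasurable_funM => //; apply/measurable_EFinP.
      apply: (measurable_prod (h := fun i (z : Om k * n.-tuple traj) =>
        p (theta k z.1) (tnth z.2 i))) => i _.
      exact: (measurableT_comp mp (mtn i)).
    by move=> z; exact: pr0.
  + apply: (measurable_of_history kK1); apply/measurable_EFinP.
    apply: measurable_funD; first exact: measurable_enorm_sqr.
    apply: measurable_funM => //.
    by apply: (@measurable_sum _ (Om k)) => i; exact: measurable_funX.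
  + by move=> w _; exact: Fle.
- by move=> w t; exact: traj_pdf_ge0.
- by move=> w; exact: integral_traj_pdf.
- by move=> E F mE hF; exact: iid.
Qed.

Let mv k j : (j < k)%N -> (k <= K.+1)%N -> hist_vec tau k (v j).
Proof.
move=> jk kK; have [] := @run_measurable j; first by rewrite -ltnS (leq_trans jk).
by move=> _; exact: hist_vec_le.
Qed.

Lemma measurable_grad_theta k : (k <= K)%N ->
  hist_vec tau k (fun w => grad J (theta k w)).
Proof.
move=> kK i.
have cg : continuous (fun x => grad J x 0 i) by move=> x; exact:
    (continuous_grad_coord consts).
have h := @measurable_fun_param _ _ _ _ traj _ tau k
  (fun x _ => grad J x 0 i) (theta k) (fun x => measurable_cst _)
  (fun _ => cg) (mtheta kK).
have h2 : measurable_fun setT (fun w : Om k => (w, point : traj)).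
  by apply/measurable_fun_pairP; split; [exact: measurable_id|exact: measurable_cst].
exact: (measurableT_comp h h2).
Qed.

Definition gradient_error k w := v k w - grad J (theta k w).

Lemma measurable_gradient_error k : (k <= K)%N ->
  hist_vec tau k.+1 (gradient_error k).
Proof.
move=> kK; apply: hist_vecB; first exact: mv.
by apply: hist_vec_le (measurable_grad_theta kK).
Qed.

(** The weights of the average sum to 1, so grad J can be subtracted from every
    term; their squares sum to 1/N, and N was chosen for this bound. *)
Lemma error_big k : (k <= K)%N -> (m %| k)%N ->
  (\int[P]_w (enorm (gradient_error k w) ^+ 2)%:E <=
   \int[P]_w ((beta / m%:R * bsum k w + eps) / alpha)%:E)%E.
Proof.
move=> kK mk.
have mvk j : (j < k)%N -> hist_vec tau k (v j).
  by move=> jk; apply: mv => //; exact: leqW.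
have -> : (\int[P]_w (enorm (gradient_error k w) ^+ 2)%:E = \int[P]_w
    (enorm (0 + \sum_(i < Nmax) a k i w *: big_noise M pi g (theta k w) (tau k i w))
        ^+ 2)%:E)%E.
  apply: eq_integral => w _; congr (enorm _ ^+ 2)%:E.
  rewrite add0r /gradient_error (abaspider_big run)//.
  rewrite (big_batch_weight_sum (fun i => g (tau k i w) (theta k w)) (big_batch_le k
      w)).
  under [RHS]eq_bigr do rewrite /big_noise scalerBr.
  rewrite sumrB -scaler_suml; congr (_ - _).
  have NN : (0 < N k w <= Nmax)%N by rewrite big_batch_gt0 big_batch_le.
  by rewrite (big_batch_weight1 R NN) scale1r.
apply: le_trans (@batch_second_moment k Nmax (fun=> 0) (a k)
  (fun w => big_noise M pi g (theta k w)) (fun=> sigma ^+ 2) kK _ _ _ _ _) _.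
- by move=> i; exact: measurable_cst.
- by move=> i; exact: measurable_batch_weight.
- move=> j; rewrite /big_noise; under eq_fun do rewrite coordB.
  apply: measurable_funB.
    apply: (@measurable_fun_param _ _ _ _ _ _ tau k (fun x t => g t x 0 j) (theta k))
        => //.
    - by move=> t; exact: continuous_g_coord consts t j.
    - exact: mtheta.
  exact: (measurableT_comp (measurable_grad_theta kK j) measurable_fst).
- exact: measurable_cst.
- by move=> w; exact: (centered_big_noise ppi mg unb var consts).
apply: ge0_le_integral => //.
- move=> w _; rewrite lee_fin addr_ge0 ?sqr_ge0// mulr_ge0 ?sqr_ge0//.
  by apply: sumr_ge0 => i _; exact: sqr_ge0.
- apply: (measurable_of_history (leqW kK)); apply/measurable_EFinP.
  apply: measurable_funD; first exact: measurable_cst.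
  apply: measurable_funM; last exact: measurable_cst.
  apply: (@measurable_sum _ (Om k)) => i; apply: measurable_funX.
  exact: measurable_batch_weight.
- apply: (measurable_of_history (leqW kK)); apply/measurable_EFinP.
  apply: measurable_funM; last exact: measurable_cst.
  apply: measurable_funD; last exact: measurable_cst.
  by apply: measurable_funM; [exact: measurable_cst|exact: measurable_bsum].
move=> w _; rewrite lee_fin.
have NN : (0 < N k w <= Nmax)%N by rewrite big_batch_gt0 big_batch_le.
rewrite (big_batch_weight_sqr R NN) enorm_sqr big1 ?add0r => [|i _]; last first.
  by rewrite mxE expr0n.
by rewrite mulrC big_batch_variance.
Qed.

(** e_{k+1} is e_k, known from the past, plus the mean of B independent copies of
    the noise of the increment. *)
Lemma error_small k : (k < K)%N -> ~~ (m %| k.+1)%N ->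
  (\int[P]_w (enorm (gradient_error k.+1 w) ^+ 2)%:E <=
   \int[P]_w (enorm (gradient_error k w) ^+ 2 +
              Q * eta ^+ 2 / B%:R * enorm (v k w) ^+ 2)%:E)%E.
Proof.
move=> kK nmk; have kK' := ltnW kK.
have mth1 := mtheta kK; have mth := hist_vec_le (leqnSn k) (mtheta kK').
have -> : (\int[P]_w (enorm (gradient_error k.+1 w) ^+ 2)%:E = \int[P]_w
    (enorm (gradient_error k w + \sum_(i < B) B%:R^-1 *:
       small_noise M pi g (theta k.+1 w) (theta k w) (tau k.+1 i w)) ^+ 2)%:E)%E.
  apply: eq_integral => w _; congr (enorm _ ^+ 2)%:E.
  rewrite /gradient_error (abaspider_small run)//= -scaler_sumr.
  set F := \sum_(i < B) _.
  have -> : \sum_(i < B) small_noise M pi g (theta k.+1 w) (theta k w) (tau k.+1 i w) =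
      F - B%:R *: (grad J (theta k.+1 w) - grad J (theta k w)).
    by rewrite /small_noise sumrB sumr_const card_ord scaler_nat.
  rewrite scalerBr scalerA mulVf ?scale1r; last by rewrite pnatr_eq0 -lt0n.
  move: (B%:R^-1 *: F) (v k w) (grad J (theta k.+1 w)) (grad J (theta k w)).
  by move=> a0 u x y; apply/rowP => j; rewrite !mxE; ring.
rewrite [leRHS](_ : _ = \int[P]_w (enorm (gradient_error k w) ^+ 2 +
    (\sum_(i < B) (B%:R^-1 : R) ^+ 2) * (Q * enorm (theta k.+1 w - theta k w) ^+
        2))%:E)%E; last first.
  apply: eq_integral => w _; rewrite (abaspider_step run)//.
  rewrite [theta k w + _]addrC addrK; congr ((_ + _)%:E).
  rewrite sumr_const card_ord -[_ *+ B]mulr_natl enormZ_sqr.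
  by field; rewrite pnatr_eq0 -lt0n.
apply: (@batch_second_moment k.+1 B (gradient_error k) (fun _ _ => B%:R^-1)
  (fun w => small_noise M pi g (theta k.+1 w) (theta k w))
  (fun w => Q * enorm (theta k.+1 w - theta k w) ^+ 2)) => //.
- exact: measurable_gradient_error.
- move=> j.
  have mgp u : hist_vec tau k.+1 u ->
      measurable_fun setT (fun z : Om k.+1 * traj => g z.2 (u z.1) 0 j).
    move=> mu; apply: (@measurable_fun_param _ _ _ _ _ _ tau k.+1 (fun x t => g t x 0
        j) u) => //.
    by move=> t; exact: continuous_g_coord consts t j.
  have mpp u : hist_vec tau k.+1 u ->
      measurable_fun setT (fun z : Om k.+1 * traj => p (u z.1) z.2).
    move=> mu; apply: (@measurable_fun_param _ _ _ _ _ _ tau k.+1 (fun x t =>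
        traj_pdf M pi x t) u) => //.
      by move=> x; exact: measurable_traj_pdf.
    by move=> t; exact: continuous_traj_pdf scores t.
  have -> : (fun z : Om k.+1 * traj =>
        small_noise M pi g (theta k.+1 z.1) (theta k z.1) z.2 0 j) =
      (fun z => g z.2 (theta k.+1 z.1) 0 j -
         p (theta k z.1) z.2 / p (theta k.+1 z.1) z.2 * g z.2 (theta k z.1) 0 j -
         (grad J (theta k.+1 z.1) 0 j - grad J (theta k z.1) 0 j)).
    by apply/funext => z; rewrite /small_noise !coordB scale_coord.
  have mG1 := measurable_grad_theta kK j.
  have mG0 := hist_vec_le (leqnSn k) (measurable_grad_theta kK') j.
  apply: measurable_funB; last first.
    exact: (measurableT_comp (measurable_funB mG1 mG0) measurable_fst).
  apply: measurable_funB; first exact: mgp.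
  apply: measurable_funM; last exact: mgp.
  apply: measurable_funM; first exact: mpp.
  apply: measurable_funV_ge0; last exact: mpp.
  by move=> z; exact: traj_pdf_ge0.
- apply: measurable_funM; first exact: measurable_cst.
  by apply: measurable_enorm_sqr; exact: hist_vecB.
- by move=> w; exact: (centered_small_noise ppi mg unb scores consts).
Qed.
Local Notation Eerr k := (\int[P]_w (enorm (gradient_error k w) ^+ 2)%:E)%E.
Local Notation Evel k := (\int[P]_w (enorm (v k w) ^+ 2)%:E)%E.
Local Notation Egrad k := (\int[P]_w (enorm (grad J (theta k w)) ^+ 2)%:E)%E.

Let mEerr k : (k <= K)%N ->
  measurable_fun setT (fun w => (enorm (gradient_error k w) ^+ 2)%:E).
Proof.
move=> kK; apply/measurable_EFinP; apply: (@measurable_of_history k.+1) => //.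
by apply: measurable_enorm_sqr; exact: measurable_gradient_error.
Qed.

Let mEvel k : (k <= K)%N -> measurable_fun setT (fun w => (enorm (v k w) ^+ 2)%:E).
Proof.
move=> kK; apply/measurable_EFinP; apply: (@measurable_of_history k.+1) => //.
by apply: measurable_enorm_sqr; exact: mv.
Qed.

Let mEgrad k : (k <= K)%N ->
  measurable_fun setT (fun w => (enorm (grad J (theta k w)) ^+ 2)%:E).
Proof.
move=> kK; apply/measurable_EFinP; apply: (@measurable_of_history k); first exact: leqW.
by apply: measurable_enorm_sqr; exact: measurable_grad_theta.
Qed.

Let sqr0 (f : Omega -> 'rV[R]_d) w : (0 <= (enorm (f w) ^+ 2)%:E)%E.
Proof. by rewrite lee_fin sqr_ge0. Qed.

Let int0 (f : Omega -> 'rV[R]_d) : (0 <= \int[P]_w (enorm (f w) ^+ 2)%:E)%E.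
Proof. by apply: integral_ge0. Qed.

Let int_cst (c : R) : (\int[P]_w c%:E = c%:E)%E.
Proof.
transitivity (c%:E * P setT)%E; first exact: (integral_cst P measurableT c%:E).
by rewrite probability_setT mule1.
Qed.

Lemma integral_error_big_le k : (k <= K)%N -> (m %| k)%N ->
  (Eerr k <= (beta / m%:R / alpha)%:E *
     \sum_((k %/ m * m)%N - m <= i < (k %/ m * m)%N) Evel i + (eps / alpha)%:E)%E.
Proof.
move=> kK mk; apply: le_trans (error_big kK mk) _.
have c0 : 0 <= beta / m%:R / alpha by rewrite !divr_ge0// ltW.
pose F i w := if (i < k)%N then (enorm (v i w) ^+ 2)%:E else 0%E.
have mF i : measurable_fun setT (F i).
  rewrite /F; have [ik|_] := boolP (i < k)%N; last exact: measurable_cst.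
  by apply: mEvel; exact: leq_trans (ltnW ik) kK.
have F0 i w : (0 <= F i w)%E by rewrite /F; case: ifP.
have FE i : ((k %/ m * m)%N - m <= i < (k %/ m * m)%N)%N -> (i < k)%N.
  by move=> /andP[_ ik]; rewrite (leq_trans ik) ?leq_divM.
rewrite [leLHS](_ : _ = \int[P]_w ((beta / m%:R / alpha)%:E *
   \sum_((k %/ m * m)%N - m <= i < (k %/ m * m)%N) F i w + (eps / alpha)%:E))%E; last
       first.
  apply: eq_integral => w _.
  have -> : (\sum_((k %/ m * m)%N - m <= i < (k %/ m * m)%N) F i w = (bsum k w)%:E)%E.
    rewrite -sumEFin [LHS]big_nat [RHS]big_nat; apply: eq_bigr => i /FE ik.
    by rewrite /F ik.
  by rewrite -EFinM -EFinD mulrDl mulrAC.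
rewrite ge0_integralD//; last 3 first.
- by move=> w _; rewrite mule_ge0 ?lee_fin// sume_ge0.
- by apply: emeasurable_funM => //; exact: emeasurable_sum.
- by move=> w _; rewrite lee_fin divr_ge0// ltW.
rewrite ge0_integralZl//; last 2 first.
- exact: emeasurable_sum.
- by move=> w _; rewrite sume_ge0.
rewrite int_cst leeD2r// lee_wpmul2l ?lee_fin//.
rewrite ge0_integral_sum// big_nat [leRHS]big_nat; apply: lee_sum => i /FE ik.
by under eq_integral do rewrite /F ik.
Qed.

Lemma integral_error_small_le k : (k < K)%N -> ~~ (m %| k.+1)%N ->
  (Eerr k.+1 <= Eerr k + (Q * eta ^+ 2 / B%:R)%:E * Evel k)%E.
Proof.
move=> kK nmk; apply: le_trans (error_small kK nmk) _.
have kK' := ltnW kK.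
have c0 : 0 <= Q * eta ^+ 2 / B%:R.
  by rewrite divr_ge0// mulr_ge0 ?sqr_ge0//; exact: (problem_Q_ge0 consts point).
rewrite -ge0_integralZl//; last exact: mEvel.
rewrite -ge0_integralD//; last 3 first.
- exact: mEerr.
- by move=> w _; rewrite mule_ge0 ?lee_fin// sqr_ge0.
- by apply: emeasurable_funM => //; exact: mEvel.

Qed.

Lemma integral_grad_le k : (k <= K)%N -> (Egrad k <= (d%:R * Num.sqrt Gamma ^+ 2)%:E)%E.
Proof.
move=> kK; rewrite -[leRHS]int_cst.
apply: ge0_le_integral => //.
- by move=> w _; rewrite lee_fin sqr_ge0.
- exact: mEgrad.
- by move=> w _; rewrite lee_fin; exact: grad_enorm_le ppi mg unb consts _.
Qed.

Lemma integral_velocity_le k : (k <= K)%N -> (Evel k <= 2%:E * Eerr k + 2%:E * Egrad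
    k)%E.
Proof.
move=> kK.
rewrite -ge0_integralZl//; last exact: mEerr.
rewrite -ge0_integralZl//; last 2 first.
- exact: mEgrad.
- by move=> w _; rewrite lee_fin sqr_ge0.
rewrite -ge0_integralD//; last 4 first.
- by move=> w _; rewrite mule_ge0 ?lee_fin ?sqr_ge0.
- by apply: emeasurable_funM => //; exact: mEerr.
- by move=> w _; rewrite mule_ge0 ?lee_fin ?sqr_ge0.
- by apply: emeasurable_funM => //; exact: mEgrad.
apply: ge0_le_integral => //.
- exact: mEvel.
- by apply: emeasurable_funD; apply: emeasurable_funM => //; [exact: mEerr|exact:
    mEgrad].
move=> w _; rewrite -!EFinM -EFinD lee_fin.
rewrite -{1}(subrK (grad J (theta k w)) (v k w)).
exact: enormD_sqr_le.
Qed.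

(** Finiteness has to be proved along the run: importance weights need not
    be bounded, so neither need the v_k. *)
Lemma integral_error_lty k : (k <= K)%N -> (Eerr k < +oo)%E.
Proof.
elim/ltn_ind: k => k IH kK.
have velfin i : (i < k)%N -> (Evel i < +oo)%E.
  move=> ik; have iK : (i <= K)%N := leq_trans (ltnW ik) kK.
  apply: le_lt_trans (integral_velocity_le iK) _; rewrite lte_add_pinfty//
      lte_mul_pinfty//.
    exact: IH.
  exact: le_lt_trans (integral_grad_le iK) (ltry _).
have [mk|nmk] := boolP (m %| k)%N.
  apply: le_lt_trans (integral_error_big_le kK mk) _.
  rewrite lte_add_pinfty ?ltry// lte_mul_pinfty//.
  - by rewrite lee_fin !divr_ge0// ltW.
  rewrite big_nat; apply: lte_sum_pinfty => i /andP[_ ik]; apply: velfin.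
  by rewrite (leq_trans ik) ?leq_divM.
case: k nmk kK IH velfin => [|k] nmk kK IH velfin; first by rewrite dvdn0 in nmk.
apply: le_lt_trans (integral_error_small_le kK nmk) _.
rewrite lte_add_pinfty ?IH//; first exact: ltnW.
rewrite lte_mul_pinfty ?velfin// lee_fin divr_ge0// mulr_ge0 ?sqr_ge0//.
exact: (problem_Q_ge0 consts point).
Qed.

Lemma integral_velocity_lty k : (k <= K)%N -> (Evel k < +oo)%E.
Proof.
move=> kK; apply: le_lt_trans (integral_velocity_le kK) _.
rewrite lte_add_pinfty// lte_mul_pinfty//; first exact: integral_error_lty.
exact: le_lt_trans (integral_grad_le kK) (ltry _).
Qed.

(** Second moments as real numbers, which are the true ones by
    [integral_error_lty] and its companions. *)
Definition mean_sqr (f : Omega -> 'rV[R]_d) : R :=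
  fine (\int[P]_w (enorm (f w) ^+ 2)%:E)%E.

Let mean_sqrE f : (\int[P]_w (enorm (f w) ^+ 2)%:E < +oo)%E ->
  (\int[P]_w (enorm (f w) ^+ 2)%:E = (mean_sqr f)%:E)%E.
Proof. by move=> h; rewrite fineK// ge0_fin_numE. Qed.

Local Notation er k := (mean_sqr (gradient_error k)).
Local Notation ve k := (mean_sqr (v k)).
Local Notation gr k := (mean_sqr (fun w => grad J (theta k w))).

Lemma mean_sqr_ge0 f : 0 <= mean_sqr f.
Proof. by rewrite fine_ge0. Qed.

Lemma integral_errorE k : (k <= K)%N -> (Eerr k = (er k)%:E)%E.
Proof. by move=> kK; rewrite mean_sqrE//; exact: integral_error_lty. Qed.

Lemma integral_velocityE k : (k <= K)%N -> (Evel k = (ve k)%:E)%E.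
Proof. by move=> kK; rewrite mean_sqrE//; exact: integral_velocity_lty. Qed.

Lemma integral_gradE k : (k <= K)%N -> (Egrad k = (gr k)%:E)%E.
Proof.
move=> kK; apply: mean_sqrE; exact: le_lt_trans (integral_grad_le kK) (ltry _).
Qed.

Lemma mean_error_big k : (k <= K)%N -> (m %| k)%N ->
  er k <= beta / m%:R / alpha *
     (\sum_((k %/ m * m)%N - m <= i < (k %/ m * m)%N) ve i) + eps / alpha.
Proof.
move=> kK mk; have := integral_error_big_le kK mk; rewrite (integral_errorE kK).
rewrite (_ : (\sum_(_ <= i < _) _)%E =
  (\sum_((k %/ m * m)%N - m <= i < (k %/ m * m)%N) ve i)%:E) ?lee_fin//.
rewrite -sumEFin [LHS]big_nat [RHS]big_nat; apply: eq_bigr => i /andP[_ ik].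
by apply: integral_velocityE; apply: leq_trans kK; apply: ltnW; rewrite (leq_trans
    ik) ?leq_divM.
Qed.

Lemma mean_error_small k : (k < K)%N -> ~~ (m %| k.+1)%N ->
  er k.+1 <= er k + Q * eta ^+ 2 / B%:R * ve k.
Proof.
move=> kK nmk; have kK' := ltnW kK.
exact: fine_le_affine (integral_errorE kK) (integral_errorE kK') (integral_velocityE
    kK') (integral_error_small_le kK nmk).
Qed.

(** The telescoping is pointwise, and J (theta K.+1) is replaced by its upper
    bound before integrating. *)
Lemma mean_ascent Jmax : eta = (2 * L)^-1 -> (forall x, J x <= Jmax) ->
  \sum_(k < K.+1) gr k + 2^-1 * \sum_(k < K.+1) ve k <=
  4 * L * (Jmax - J theta0) + \sum_(k < K.+1) er k.
Proof.
move=> etaE JJ; have L0 := problem_L_gt0 consts.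
have dJ x : differentiable J x by have [] := unb x.
have Jlip : forall x y, enorm (grad J x - grad J y) <= L * enorm (x - y).
  by case: consts.
have pw n w : (n <= K.+1)%N ->
    \sum_(k < n) (enorm (grad J (theta k w)) ^+ 2 + 2^-1 * enorm (v k w) ^+ 2) <=
    4 * L * (J (theta n w) - J theta0) + \sum_(k < n) enorm (gradient_error k w) ^+ 2.
  elim: n => [_|n IH nK].
    by rewrite !big_ord0 (abaspider_init run) subrr mulr0 addr0.
  rewrite !big_ord_recr /=; have := IH (ltnW nK).
  have := ascent_step L0 dJ Jlip (erefl (gradient_error n w)).
  by rewrite -etaE -(abaspider_step run) //; lra.
have C0 : 0 <= 4 * L * (Jmax - J theta0) by rewrite mulr_ge0 ?subr_ge0// mulr_ge0// ltW.
have lek (k : 'I_K.+1) : (k <= K)%N by rewrite -ltnS.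
have := @ge0_le_integral _ _ _ P setT measurableT
  (fun w => \sum_(k < K.+1) ((enorm (grad J (theta k w)) ^+ 2)%:E +
               (2^-1)%:E * (enorm (v k w) ^+ 2)%:E))%E
  (fun w => (4 * L * (Jmax - J theta0))%:E +
     \sum_(k < K.+1) (enorm (gradient_error k w) ^+ 2)%:E)%E.
have gv0 k w : (0 <= (enorm (grad J (theta k w)) ^+ 2)%:E +
               (2^-1)%:E * (enorm (v k w) ^+ 2)%:E)%E.
  by rewrite -EFinM -EFinD lee_fin addr_ge0 ?sqr_ge0// mulr_ge0 ?sqr_ge0.
have mgv (k : 'I_K.+1) : measurable_fun setT (fun w => (enorm (grad J (theta k w)) ^+
    2)%:E +
               (2^-1)%:E * (enorm (v k w) ^+ 2)%:E)%E.
  apply: emeasurable_funD; first exact: mEgrad.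
  by apply: emeasurable_funM => //; exact: mEvel.
rewrite ge0_integral_sum//.
rewrite ge0_integralD//; last 2 first.
- by move=> w _; apply: sume_ge0.
- by apply: emeasurable_sum => k; exact: mEerr.
rewrite int_cst ge0_integral_sum//; last by move=> k; exact: mEerr.
have -> : (\sum_(k < K.+1) \int[P]_w ((enorm (grad J (theta k w)) ^+ 2)%:E +
    (2^-1)%:E * (enorm (v k w) ^+ 2)%:E) =
   (\sum_(k < K.+1) gr k + 2^-1 * \sum_(k < K.+1) ve k)%:E)%E.
  rewrite mulr_sumr -big_split -sumEFin; apply: eq_bigr => k _ /=.
  rewrite ge0_integralD//; last 4 first.
  - by move=> w _; rewrite lee_fin sqr_ge0.
  - exact: mEgrad.
  - by move=> w _; rewrite -EFinM lee_fin mulr_ge0 ?sqr_ge0.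
  - by apply: emeasurable_funM => //; exact: mEvel.
  rewrite ge0_integralZl//; last exact: mEvel.
  rewrite EFinD EFinM; congr (_ + _ * _)%E; first exact: integral_gradE.
  exact: integral_velocityE.
have -> : (\sum_(k < K.+1) Eerr k = (\sum_(k < K.+1) er k)%:E)%E.
  by rewrite -sumEFin; apply: eq_bigr => k _; rewrite (integral_errorE (lek k)).
rewrite -EFinD lee_fin; apply.
- by move=> w _; apply: sume_ge0.
- by apply: emeasurable_sum => k; exact: mgv.
- apply: emeasurable_funD; first exact: measurable_cst.
  by apply: emeasurable_sum => k; exact: mEerr.
move=> w _; rewrite [leLHS](_ : _ = (\sum_(k < K.+1)
    (enorm (grad J (theta k w)) ^+ 2 + 2^-1 * enorm (v k w) ^+ 2))%:E); last first.
  by rewrite -sumEFin; apply: eq_bigr => k _; rewrite -EFinM -EFinD.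
rewrite sumEFin -EFinD lee_fin; apply: le_trans (pw _ w (leqnn _)) _.
by rewrite lerD2r ler_wpM2l ?mulr_ge0 ?(ltW L0)// lerD2r.
Qed.

(** All the theta_k with k <= K belong to the history before iteration K.+1, of
    which each event xi = k is independent. *)
Lemma mean_output (xi : Omega -> 'I_K.+1) : uniform_output P tau xi ->
  (\int[P]_w (enorm (grad J (theta (xi w) w)) ^+ 2)%:E =
   (K.+1%:R^-1 * \sum_(k < K.+1) gr k)%:E)%E.
Proof.
move=> uxi; have lek (k : 'I_K.+1) : (k <= K)%N by rewrite -ltnS.
pose D (k : 'I_K.+1) := xi @^-1` [set k].
have mD k : measurable (D k) by have [] := uxi k.
transitivity (\int[P]_w \sum_(k < K.+1)
    ((\1_(D k) w)%:E * (enorm (grad J (theta k w)) ^+ 2)%:E))%E.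
  apply: eq_integral => w _; rewrite (bigD1 (xi w))//= indicE mem_set// mul1e.
  rewrite big1 ?adde0// => k kxi; rewrite indicE memNset ?mul0e//.
  by move=> /= xik; rewrite -xik eqxx in kxi.
rewrite ge0_integral_sum//; last 2 first.
- move=> k; apply: emeasurable_funM; last exact: mEgrad.
  by apply/measurable_EFinP; exact: measurable_indic.
- by move=> k w _; rewrite mule_ge0// lee_fin sqr_ge0.
rewrite mulr_sumr -sumEFin; apply: eq_bigr => k _.
have [_ Dk] := uxi k.
rewrite (@ge0_integral_indep _ _ _ P (draw_events tau K.+1)
  (draw_events_measurable (leqnn _)) (D k) K.+1%:R^-1)//.
- by rewrite (integral_gradE (lek k)).
- apply/measurable_EFinP; apply: measurable_enorm_sqr.
  by apply: hist_vec_le (measurable_grad_theta (lek k)); exact: leqW.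
- by move=> w; rewrite lee_fin sqr_ge0.
Qed.

End abaspider.

(** * Charging the errors to the velocities *)

Lemma sum_interval_le (R : realType) (n a m : nat) :
  \sum_(k < n) (a <= k < a + m)%N%:R <= m%:R :> R.
Proof.
rewrite -natr_sum ler_nat.
have -> : (\sum_(k < n) (a <= k < a + m))%N = minn (n - a) m.
  elim: n => [|n IH]; first by rewrite big_ord0 sub0n min0n.
  by rewrite big_ord_recr /= IH; case: leqP => h1; case: ltnP => h2 /=; lia.
exact: geq_minr.
Qed.

(** Unrolling the recursion back to the last restart nk, the error of iteration k
    is charged to the ve i of the previous epoch with weight c1 and to those with
    nk <= i < k with weight c. After exchanging sums, a given i receives the first
    charge from the m iterations of the next epoch and the second one from at most
    m - 1 iterations. *)
Lemma epoch_sum (R : realType) (K m : nat) (er ve : nat -> R) (c c1 e0 : R) :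
  (0 < m)%N -> (forall k, 0 <= ve k) -> 0 <= c -> 0 <= c1 ->
  (forall k, (k <= K)%N -> (m %| k)%N ->
    er k <= c1 * (\sum_((k %/ m * m)%N - m <= i < (k %/ m * m)%N) ve i) + e0) ->
  (forall k, (k < K)%N -> ~~ (m %| k.+1)%N -> er k.+1 <= er k + c * ve k) ->
  \sum_(k < K.+1) er k <=
    K.+1%:R * e0 + (c1 * m%:R + c * (m%:R - 1)) * \sum_(k < K.+1) ve k.
Proof.
move=> m0 ve0 c0 c10 big small.
have le_nat_of_bool (b b' : bool) : (b -> b') -> (b <= b')%N.
  by case: b; case: b' => // ->.
pose nk k := (k %/ m * m)%N.
have nkle k : (nk k <= k)%N by exact: leq_divM.
have nklt k : (k < nk k + m)%N by rewrite /nk {1}(divn_eq k m) ltn_add2l ltn_mod.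
have bound k : (k <= K)%N -> er k <= c1 * (\sum_(nk k - m <= i < nk k) ve i) + e0 +
    c * \sum_(nk k <= i < k) ve i.
  elim: k => [|k IH] kK.
    by apply: le_trans (big 0%N isT (dvdn0 _)) _; rewrite lerDl mulr_ge0// sumr_ge0.
  have [mk|nmk] := boolP (m %| k.+1)%N.
    by apply: le_trans (big _ kK mk) _; rewrite lerDl mulr_ge0// sumr_ge0.
  have nkS : nk k.+1 = nk k.
    by rewrite /nk divnS// (negbTE nmk) add0n.
  apply: le_trans (small k kK nmk) _; rewrite nkS.
  rewrite big_nat_recr//= mulrDr addrA lerD2r; exact: IH (ltnW kK).
pose r1 (k i : nat) : R := (nk k - m <= i < nk k)%N%:R.
pose r2 (k i : nat) : R := (nk k <= i < k)%N%:R.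
have widen a b k : (b <= k)%N -> (k <= K)%N ->
    \sum_(a <= i < b) ve i = \sum_(i < K.+1) (a <= i < b)%N%:R * ve i.
  move=> bk kK.
  rewrite -(big_mkord xpredT (fun i => (a <= i < b)%N%:R * ve i)).
  transitivity (\sum_(0 <= i < K.+1 | (a <= i < b)%N) ve i); last first.
    by rewrite [LHS]big_mkcond; apply: eq_bigr => i _; case: ifP => _; rewrite ?mul1r
        ?mul0r.
  rewrite [LHS]big_geq_mkord [RHS]big_mkord.
  rewrite (big_ord_widen_cond K.+1 (fun i => (a <= i)%N) ve); last first.
    by apply: leq_trans bk _; apply: leqW.
  by [].
have bound' (k : 'I_K.+1) : er k <=
    e0 + \sum_(i < K.+1) (c1 * r1 k i + c * r2 k i) * ve i.
  have kK : (k <= K)%N by rewrite -ltnS.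
  apply: le_trans (bound k kK) _.
  rewrite (widen _ _ k) ?nkle// (widen (nk k) k k)//.
  rewrite !mulr_sumr addrAC addrC lerD2l -big_split /=.
  by apply: ler_sum => i _; rewrite mulrDl !mulrA.
apply: (@le_trans _ _ (\sum_(k < K.+1) (e0 + \sum_(i < K.+1) (c1 * r1 k i + c * r2 k
    i) * ve i))).
  by apply: ler_sum => k _; exact: bound'.
rewrite big_split /= sumr_const card_ord -[e0 *+ _]mulr_natl lerD2l exchange_big /=
    mulr_sumr.
apply: ler_sum => i _; rewrite -mulr_suml ler_wpM2r// big_split /= -!mulr_sumr.
apply: lerD; rewrite ler_wpM2l//.
  apply: le_trans (sum_interval_le R K.+1 ((i %/ m).+1 * m)%N m).
  apply: ler_sum => k _; rewrite ler_nat; apply: le_nat_of_bool => /andP[h1 h2].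
  have <- : (k %/ m = (i %/ m).+1)%N.
    apply/eqP; rewrite eqn_leq ltn_divLR// h2 andbT.
    have : (k %/ m - 1 <= i %/ m)%N by rewrite leq_divRL// mulnBl mul1n.
    by rewrite leq_subLR add1n.
  by rewrite nkle nklt.
have -> : m%:R - 1 = m.-1%:R :> R by rewrite -[in LHS](prednK m0) -natr1 addrK.
apply: le_trans (sum_interval_le R K.+1 i.+1 m.-1).
apply: ler_sum => k _; rewrite ler_nat; apply: le_nat_of_bool => /andP[h1 h2].
by rewrite h2 addSn -addnS prednK// (leq_trans (nklt k))// leq_add2r.
Qed.

Theorem theorem4 (R : realType) (dS dA : measure_display)
    (S : measurableType dS) (A : measurableType dA)
    (M : mdp R S A) (H d : nat)
    (pi : 'rV[R]_d -> S -> A -> R)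
    (g : H.-tuple (S * A)%type -> 'rV[R]_d -> 'rV[R]_d)
    (G CH Rmax sigma L Lg Gamma alphaw eps : R)
    (theta0 theta_star : 'rV[R]_d) (K : nat)
    (dO : measure_display) (Omega : measurableType dO)
    (P : probability Omega R)
    (tau : nat -> nat -> Omega -> H.-tuple (S * A)%type)
    (theta v : nat -> Omega -> 'rV[R]_d) (xi : Omega -> 'I_K.+1) :
  let J := perf M H pi in
  let Q := 2 * (Lg ^+ 2 + Gamma * alphaw) in
  let eta := (2 * L)^-1 in
  let m := roundup (L * sigma / Num.sqrt (Q * eps)) in
  let B := roundup (sigma * Num.sqrt Q / (L * Num.sqrt eps)) in
  is_policy M pi ->
  (forall x i, measurable_fun setT (fun t => g t x 0 i)) ->
  unbiased M pi g ->
  bounded_scores M pi G CH Rmax ->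
  0 <= sigma -> bounded_variance M pi g sigma ->
  problem_constants M pi g L Lg Gamma alphaw ->
  (forall x, J x <= J theta_star) ->
  0 < eps ->
  abaspider_pg M pi P g theta0 sigma eta eps 48 6 m B K tau theta v ->
  uniform_output P tau xi ->
  (\int[P]_w (enorm (grad J (theta (xi w) w)) ^+ 2)%:E <=
   (40 * L / K.+1%:R * (J theta_star - J theta0) + eps / 2)%:E)%E.
Proof.
move=> J Q eta m B ppi mg unb scores sigma0 var consts Jmax eps0 run uxi.
have L0 : 0 < L := problem_L_gt0 consts.
have Q0 : 0 <= Q := problem_Q_ge0 consts point.
have m0 : (0 < m)%N := roundup_gt0 _.
have B0 : (0 < B)%N := roundup_gt0 _.
have BR0 : 0 < B%:R :> R by rewrite ltr0n.
have mR0 : 0 < m%:R :> R by rewrite ltr0n.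
have alpha0 : 0 < 48 :> R by [].
have beta0 : 0 <= 6 :> R by [].
rewrite (mean_output ppi mg unb scores consts eps0 alpha0 beta0 run uxi) lee_fin.
set gr := fun k => mean_sqr P (fun w => grad J (theta k w)).
set ve := fun k => mean_sqr P (v k).
set er := fun k => mean_sqr P (gradient_error M H pi theta v k).
have sum_gr : \sum_(k < K.+1) gr k + 2^-1 * \sum_(k < K.+1) ve k <=
    4 * L * (J theta_star - J theta0) + \sum_(k < K.+1) er k.
  exact: (mean_ascent ppi mg unb scores var consts eps0 alpha0 beta0 B0 run erefl Jmax).
pose c := Q * eta ^+ 2 / B%:R.
have c0 : 0 <= c by rewrite divr_ge0 ?(ltW BR0)// mulr_ge0// sqr_ge0.
(* Rounding B up only decreases c, and m - 1 is at most the unrounded m; for the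
   unrounded sizes the product is exactly 1/4. When Q or sigma is 0 these sizes
   degenerate, but then c or the unrounded m vanishes. *)
have c1 : c * (m%:R - 1) <= 4^-1.
  have sQe : Num.sqrt (Q * eps) = Num.sqrt Q * Num.sqrt eps by rewrite sqrtrM.
  have e0 : 0 < Num.sqrt eps by rewrite sqrtr_gt0.
  have x0 : 0 <= L * sigma / Num.sqrt (Q * eps).
    by rewrite divr_ge0 ?sqrtr_ge0// mulr_ge0// ltW.
  have mx := roundup_pred_le x0; rewrite -/m in mx.
  have By := roundup_ge (sigma * Num.sqrt Q / (L * Num.sqrt eps)).
  rewrite -/B in By.
  apply: le_trans (ler_wpM2l c0 mx) _.
  have [Q00|Qn0] := eqVneq Q 0.
    by rewrite /c Q00 !mul0r invr_ge0.
  have [->|sn0] := eqVneq sigma 0; first by rewrite mulr0 mul0r mulr0 invr_ge0.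
  have q0 : 0 < Num.sqrt Q by rewrite sqrtr_gt0 lt_neqAle eq_sym Qn0.
  have s0 : 0 < sigma by rewrite lt_neqAle eq_sym sn0.
  have y0 : 0 < sigma * Num.sqrt Q / (L * Num.sqrt eps).
    by rewrite divr_gt0// mulr_gt0.
  apply: (@le_trans _ _ (Q * eta ^+ 2 / (sigma * Num.sqrt Q / (L * Num.sqrt eps)) *
      (L * sigma / Num.sqrt (Q * eps)))).
    apply: ler_wpM2r => //; apply: ler_wpM2l; first by rewrite mulr_ge0 ?sqr_ge0.
    by rewrite lef_pV2 ?posrE.
  rewrite sQe -{1}(sqr_sqrtr Q0) /eta le_eqVlt; apply/orP; left; apply/eqP.
  by field; rewrite !gt_eqF.
have ve0 k : 0 <= ve k by exact: mean_sqr_ge0.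
have sum_er : \sum_(k < K.+1) er k <= K.+1%:R * (eps / 48) +
    (6 / m%:R / 48 * m%:R + c * (m%:R - 1)) * \sum_(k < K.+1) ve k.
  apply: epoch_sum => //.
  - by move=> k kK mk; exact: (mean_error_big ppi mg unb scores var consts eps0
      alpha0 beta0 B0 run).
  - by move=> k kK nmk; exact: (mean_error_small ppi mg unb scores var consts eps0
      alpha0 beta0 B0 run).
have sve0 : 0 <= \sum_(k < K.+1) ve k by exact: sumr_ge0.
rewrite (_ : 6 / m%:R / 48 * m%:R = 8^-1) in sum_er; last by field; rewrite gt_eqF.
have JJ : 0 <= J theta_star - J theta0 by rewrite subr_ge0.
rewrite -(ler_pM2l (ltr0Sn R K)) mulrA divff ?mul1r; last by rewrite gt_eqF.
rewrite [leRHS](_ : _ = 40 * L * (J theta_star - J theta0) + K.+1%:R * (eps / 2));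
    last first.
  by field; rewrite nat1r gt_eqF.
have Keps : 0 <= K.+1%:R * eps by rewrite mulr_ge0// ltW.
have LJ : 0 <= L * (J theta_star - J theta0) by rewrite mulr_ge0// ltW.
nra.
Qed.
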